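(* Let $\Omega\subset\mathbb{R}^m$ be a convex domain, let $F=[f^0:f^1:\dots:f^k]$ and $\tilde F=[\tilde f^0:\tilde f^1:\dots:\tilde f^k]$ be holomorphic almost periodic mappings from $T_\Omega$ to $\mathbb{CP}^k$, and let $h$ be holomorphic on $T_\Omega$. Suppose the functions $f^l\tilde f^l/h$, $l=0,\dots,k$, are holomorphic on $T_\Omega$ and their divisors satisfy: for each $\Omega'\Subset\Omega$ there is $\delta>0$ such that every ball $B(z_0,\delta)$, $z_0\in T_{\Omega'}$, intersects at most $k$ of the supports of these divisors. Then $f^0\tilde f^0/h,\dots,f^k\tilde f^k/h$ are homogeneous coordinates of some holomorphic almost periodic mapping $T_\Omega\to\mathbb{CP}^k$.
   Context: $T_\Omega=\{x+iy:x\in\mathbb{R}^m,y\in\Omega\}$; $S_t$ is translation by $t\in\mathbb{R}^m$. A holomorphic map $T_\Omega\to\mathbb{CP}^k$ is written in homogeneous coordinates $[f^0:\dots:f^k]$ with $f^l$ holomorphic on $T_\Omega$, without common zeros and none identically zero (unique up to a common nonvanishing holomorphic factor). It is almost periodic if $\{S_tF\}_{t\in\mathbb{R}^m}$ is relatively compact in the topology of uniform convergence (Fubini–Study metric) on every $T_{\Omega'}$, $\Omega'\Subset\Omega$. *)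

(* Defs.v *)
From HB Require Import structures.
From mathcomp Require Import all_boot all_order all_algebra.
From mathcomp Require Import all_classical all_reals all_analysis.
From mathcomp Require Import complex.
Import numFieldNormedType.Exports.
Set Implicit Arguments. Unset Strict Implicit. Unset Printing Implicit Defensive.
Import Order.TTheory GRing.Theory Num.Theory.
Local Open Scope ring_scope.
Local Open Scope classical_set_scope.

Section Defs.
Variable R : realType.
Local Notation C := (R[i]).

Definition cabs (z : C) : R := Normc.normc z.

Definition vnorm n (w : 'rV[C]_n) : R := Num.sqrt (\sum_(i < n) cabs (w ord0 i) ^+ 2).

Definition hdot n (a b : 'rV[C]_n) : C := \sum_(i < n) a ord0 i * conjc (b ord0 i).

(* Fubini--Study distance between the points [a], [b] of CP^(n-1),
   a, b nonzero vectors of C^n (homogeneous coordinates) *)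
Definition fs_dist n (a b : 'rV[C]_n) : R :=
  acos (cabs (hdot a b) / (vnorm a * vnorm b)).

Definition im_part m (z : 'rV[C]_m) : 'rV[R]_m := \row_i complex.Im (z ord0 i).

Definition realv m (t : 'rV[R]_m) : 'rV[C]_m := \row_i (t ord0 i)%:C%C.

Definition tube m (O : set 'rV[R]_m) : set 'rV[C]_m := [set z | O (im_part z)].

Definition convex_domain m (O : set 'rV[R]_m) : Prop :=
  O !=set0 /\ open O /\ connected O /\
  (forall x y : 'rV[R]_m, O x -> O y -> forall t : R, 0 <= t <= 1 ->
     O ((1 - t) *: x + t *: y)).

Definition relcpt m (O' O : set 'rV[R]_m) : Prop :=
  exists K : set 'rV[R]_m, compact K /\ K `<=` O /\ O' `<=` K.

(* holomorphy on a set D of C^m (D open in applications):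
   complex Frechet differentiability at every point of D *)
Definition holo m (D : set 'rV[C]_m) (f : 'rV[C]_m -> C) : Prop :=
  forall z, D z -> exists a : 'rV[C]_m, forall eps : R, 0 < eps ->
    exists2 delta : R, 0 < delta & forall w : 'rV[C]_m, vnorm w < delta -> D (z + w) ->
      cabs (f (z + w) - f z - \sum_(i < m) a ord0 i * w ord0 i) <= eps * vnorm w.

Definition hvec m k (F : 'I_k.+1 -> 'rV[C]_m -> C) (z : 'rV[C]_m) : 'rV[C]_k.+1 :=
  \row_l F l z.

Definition hol_map m k (O : set 'rV[R]_m) (F : 'I_k.+1 -> 'rV[C]_m -> C) : Prop :=
  (forall l, holo (tube O) (F l)) /\
  (forall z, tube O z -> exists l, F l z != 0) /\
  (forall l, exists2 z, tube O z & F l z != 0).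

(* almost periodicity: {S_t F}_t relatively compact for the topology of uniform
   convergence (Fubini--Study metric) on every T_O', O' ⋐ O; stated sequentially:
   every sequence of translates has a subsequence converging in that topology
   to some map G : T_O -> CP^k (G given by nonzero homogeneous coordinates). *)
Definition almost_periodic m k (O : set 'rV[R]_m) (F : 'I_k.+1 -> 'rV[C]_m -> C) : Prop :=
  forall t : nat -> 'rV[R]_m,
    exists (phi : nat -> nat) (G : 'rV[C]_m -> 'rV[C]_k.+1),
      (forall n, (phi n < phi n.+1)%N) /\
      (forall z, tube O z -> G z != 0) /\
      (forall O', relcpt O' O -> forall eps : R, 0 < eps ->
         exists N : nat, forall n, (N <= n)%N -> forall z, tube O' z ->
           fs_dist (hvec F (z + realv (t (phi n)))) (G z) <= eps).

Definition hol_ap_map m k (O : set 'rV[R]_m) (F : 'I_k.+1 -> 'rV[C]_m -> C) : Prop :=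
  hol_map O F /\ almost_periodic O F.

Definition cball m (z0 : 'rV[C]_m) (r : R) : set 'rV[C]_m := [set z | vnorm (z - z0) < r].

(* support of the divisor of a holomorphic function g (not identically zero) on T_O:
   its zero set in T_O *)
Definition div_supp m (O : set 'rV[R]_m) (g : 'rV[C]_m -> C) : set 'rV[C]_m :=
  [set z | tube O z /\ g z = 0].

End Defs.

(* Main.v *)
Require Import Defs.
From HB Require Import structures.
From mathcomp Require Import all_boot all_order all_algebra.
From mathcomp Require Import all_classical all_reals all_analysis.
From mathcomp Require Import complex.
From mathcomp Require Import ring lra.
Import numFieldNormedType.Exports.
Import Order.TTheory GRing.Theory Num.Theory.
Local Open Scope ring_scope.
Local Open Scope classical_set_scope.

(** The coordinatewise product of projective maps is discontinuous where all products of
    coordinates vanish, so almost periodicity of [g] has to be extracted from the separation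
    hypothesis.  Pass to a subsequence of translations along which the translates of [F] and [Ft]
    converge; if the same translates of [g] were not uniformly Cauchy, recentring the bad points
    would give two sequences of translates of [F] with a common limit [P], and likewise for [Ft]
    with a limit [Q], such that the corresponding translates of [g] stay apart near some point [z0].
    No coordinate of [P] or [Q] vanishes identically, since translating back would make a coordinate
    of [F] or [Ft] vanish.  By the identity theorem some small circle around [z0] in a complex line
    avoids the zeros of all these coordinates, and there the wedge of the two translates of [g],
    normalised by coordinates of [g] without zeros near [z0], is small.  By the maximum principle it
    is small at [z0].

    Only one-variable function theory along complex lines is used.  Holomorphy is mere
    differentiability, so the mean value property rests on Goursat's bisection; the isolation of
    zeros follows from the maximum principle by dividing out one zero after the other. *)

Set Implicit Arguments.
Unset Strict Implicit.

(** * Real differential forms on rectangles *)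

(** The limits supplied by almost periodicity are bare choices of homogeneous coordinates, so
    continuity and holomorphy of [P] and [Q] have to be recovered; only ratios of their coordinates
    carry information. Closeness in projective space is therefore measured by normalised minors
    ([wclose]) rather than by the Fubini--Study angle: minors are polynomial in the coordinates,
    hence holomorphic along lines, and the condition is invariant under rescaling.

    Of the [k+1] coordinates of [g], separation leaves one without zeros in a given ball, and the
    radius can be chosen from the imaginary part of the centre alone, so one radius serves all real
    translates. That coordinate makes the normalised wedge holomorphic on a full disc, including
    points where all products but one may vanish. On the boundary circle [h] cancels from the
    quotient, which becomes a wedge of coordinate products of [F] and [Ft]. Recentring is harmless
    because tubes, and uniform convergence on them, are invariant under real shifts. *)

Lemma continuous_of_eps (R : realType) (h : R -> R) :
  (forall x (e : R), 0 < e -> exists2 d : R, 0 < d &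
     forall y, `|y - x| < d -> `|h y - h x| <= e) ->
  continuous h.
Proof.
move=> H x; apply/cvgrPdist_le => e e0.
have [d d0 Hd] := H x e e0.
near=> y; rewrite distrC; apply: Hd; rewrite distrC.
by near: y; exact: (nbhsx_ballx x d).
Unshelve. all: by end_near. Qed.

(** The primitive is the integral from [a], so its derivative is claimed only to the right of [a];
    applications place [a] strictly to the left of the interval of interest. *)
Lemma primitive_exists (R : realType) (h : R -> R) (a : R) : continuous h ->
  exists H : R -> R, forall x, a < x -> is_derive x 1 H (h x).
Proof.
move=> ch.
exists (fun x => (\int[lebesgue_measure]_(t in `[a, x]) h t)%R) => x ax.
have xu : x < x + 1 by rewrite ltrDl.
have fi : (@lebesgue_measure R).-integrable `[a, x + 1] (EFin \o h).
  apply: continuous_compact_integrable; first exact: segment_compact.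
  exact: continuous_subspaceT.
have [D E] := continuous_FTC1_closed xu fi ax (ch x).
apply: DeriveDef; first exact: D.
by rewrite -derive1E; exact: E.
Qed.

Lemma MVT_le (R : realType) (f df : R -> R) (a b : R) : a <= b ->
  (forall x, a <= x <= b -> is_derive x 1 f (df x)) ->
  exists2 c, a <= c <= b & f b - f a = df c * (b - a).
Proof.
move=> ab H.
have H1 : forall x, x \in `]a, b[%R -> is_derive x 1 f (df x).
  by move=> x xab; apply: H; rewrite !(itvP xab).
have H2 : {within `[a, b], continuous f}.
  apply: derivable_within_continuous => x xab; apply: (@ex_derive _ _ _ _ _ _ (df x)).
  by apply: H; rewrite !(itvP xab).
have [c cab E] := MVT_segment ab H1 H2.
by exists c; rewrite // !(itvP cab).
Qed.

(** Bisection with an abstract invariant [Q n x y] on the lower left corner of the [n]-th box. The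
    common point of the nested boxes has the suprema of the corner coordinates as its
    coordinates. *)
Lemma nested_quadrants (R : realType) (w h : R) (Q : nat -> R -> R -> Prop) (x0 y0 : R) :
  0 <= w -> 0 <= h ->
  (forall n x y, Q n x y -> exists x' y', Q n.+1 x' y' /\
     (x' = x \/ x' = x + w / 2 ^+ n.+1) /\ (y' = y \/ y' = y + h / 2 ^+ n.+1)) ->
  Q 0%N x0 y0 ->
  exists p q, forall n, exists x y, Q n x y /\ x <= p <= x + w / 2 ^+ n /\
    y <= q <= y + h / 2 ^+ n.
Proof.
move=> w0 h0 step Q0.
have /choice[s Hs] : forall u : nat * (R * R), exists v : R * R,
    Q u.1 u.2.1 u.2.2 -> Q u.1.+1 v.1 v.2 /\
    (v.1 = u.2.1 \/ v.1 = u.2.1 + w / 2 ^+ u.1.+1) /\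
    (v.2 = u.2.2 \/ v.2 = u.2.2 + h / 2 ^+ u.1.+1).
  move=> [n [x y]] /=.
  have [/step[x' [y' ?]]|nQ] := pselect (Q n x y); first by exists (x', y').
  by exists (x, y) => /nQ.
pose a := fix a n := if n is n'.+1 then s (n', a n') else (x0, y0).
have Qa n : Q n (a n).1 (a n).2.
  by elim: n => [//|n IH] /=; have [] := Hs (n, a n) IH.
have Sa n := (Hs (n, a n) (Qa n)).2.
have half (v : R) n : v / 2 ^+ n = v / 2 ^+ n.+1 + v / 2 ^+ n.+1.
  have : (2 ^+ n : R) != 0 by rewrite expf_neq0 // pnatr_eq0.
  by rewrite exprS => ?; field.
have v0 (v : R) n : 0 <= v -> 0 <= v / 2 ^+ n.
  by move=> ?; rewrite divr_ge0 // exprn_ge0.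
have main (u : nat -> R) v : 0 <= v ->
   (forall n, u n.+1 = u n \/ u n.+1 = u n + v / 2 ^+ n.+1) ->
   exists p, forall n, u n <= p <= u n + v / 2 ^+ n.
  move=> vp Hu.
  have uS n : u n <= u n.+1 /\ u n.+1 + v / 2 ^+ n.+1 <= u n + v / 2 ^+ n.
    have := v0 v n.+1 vp; rewrite (half v n).
    by case: (Hu n) => -> ?; lra.
  have um n k : u n <= u (n + k)%N /\ u (n + k)%N + v / 2 ^+ (n + k) <= u n + v / 2 ^+ n.
    elim: k => [|k [IH1 IH2]]; first by rewrite addn0.
    rewrite addnS; have [] := uS (n + k)%N; lra.
  have ub n k : u k <= u n + v / 2 ^+ n.
    have := v0 v n vp; have := v0 v k vp.
    have [/subnKC E|/ltnW/subnKC E] := leqP n k.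
      by have := um n (k - n)%N; rewrite E; lra.
    by have := um k (n - k)%N; rewrite E; lra.
  exists (sup (range u)) => n; apply/andP; split.
    apply: ub_le_sup; last by exists n.
    by exists (u 0%N + v / 2 ^+ 0) => _ [k _ <-].
  by apply: ge_sup; [exists (u n); exists n | move=> _ [k _ <-]].
have [p Hp] := main (fun n => (a n).1) w w0 (fun n => (Sa n).1).
have [q Hq] := main (fun n => (a n).2) h h0 (fun n => (Sa n).2).
by exists p, q => n; exists (a n).1, (a n).2.
Qed.

Lemma dist_in_segment (R : realType) (x u p t : R) :
  x <= p <= x + u -> x <= t <= x + u -> `|t - p| <= u.
Proof. by move=> Hp Ht; rewrite ler_norml; lra. Qed.

(** Subtracting two linear approximations at a common base point eliminates the base value and the
    shared increment [a]; only the increment in the other variable remains. *)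
Lemma cancel_increment (R : realType) (m0 m1 m2 a b1 b2 c : R) :
  `|m1 - m0 - (a + b1)| <= c -> `|m2 - m0 - (a + b2)| <= c -> `|m1 - m2 + (b2 - b1)| <= 2 * c.
Proof.
rewrite !ler_norml => /andP[? ?] /andP[? ?]; apply/andP; split; lra.
Qed.

Lemma edge_difference (R : realType) (f g df dg : R -> R) (x u k c : R) : 0 <= u ->
  (forall t, x <= t <= x + u -> is_derive t 1 f (df t)) ->
  (forall t, x <= t <= x + u -> is_derive t 1 g (dg t)) ->
  (forall t, x <= t <= x + u -> `|df t - dg t + k| <= c) ->
  `|f (x + u) - f x - (g (x + u) - g x) + k * u| <= c * u.
Proof.
move=> u0 Df Dg bd; have xu : x <= x + u by rewrite lerDl.
have [t Ht|t Ht E] := @MVT_le R (fun t => f t - g t) (fun t => df t - dg t) x (x + u) xu.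
  by apply: is_deriveB; [exact: Df | exact: Dg].
have -> : f (x + u) - f x - (g (x + u) - g x) + k * u = (df t - dg t + k) * u.
  transitivity (f (x + u) - g (x + u) - (f x - g x) + k * u); first by ring.
  by rewrite E; ring.
by rewrite normrM (ger0_norm u0) ler_wpM2r // bd.
Qed.

(* Goursat's bisection: the partial derivatives of the closed form [M dx + N dy] need not be continuous. *)
Lemma green_rect (R : realType) (M N A B : R -> R -> R) (x1 x2 y1 y2 : R) :
  x1 <= x2 -> y1 <= y2 ->
  (forall x y, x1 <= x <= x2 -> y1 <= y <= y2 -> is_derive x 1 (A ^~ y) (M x y)) ->
  (forall x y, x1 <= x <= x2 -> y1 <= y <= y2 -> is_derive y 1 (B x) (N x y)) ->
  (forall p q, x1 <= p <= x2 -> y1 <= q <= y2 -> exists a k b : R,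
     forall e : R, 0 < e -> exists2 d : R, 0 < d & forall x y, `|x - p| < d -> `|y - q| < d ->
       `|M x y - M p q - (a * (x - p) + k * (y - q))| <= e * (`|x - p| + `|y - q|) /\
       `|N x y - N p q - (k * (x - p) + b * (y - q))| <= e * (`|x - p| + `|y - q|)) ->
  (A x2 y1 - A x1 y1) + (B x2 y2 - B x2 y1) - (A x2 y2 - A x1 y2) - (B x1 y2 - B x1 y1) = 0.
Proof.
move=> x12 y12 dA dB loc.
pose J a b c d := (A b c - A a c) + (B b d - B b c) - (A b d - A a d) - (B a d - B a c).
rewrite -/(J x1 x2 y1 y2).
pose w := x2 - x1; pose h := y2 - y1.
have w0 : 0 <= w by rewrite subr_ge0.
have h0 : 0 <= h by rewrite subr_ge0.
have small (e : R) : 0 < e -> `|J x1 x2 y1 y2| <= 2 * e * (w + h) ^+ 2.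
  move=> e0; rewrite leNgt; apply/negP => big.
  (* The bound is quadratic in the side lengths, so quartering divides it by 4, while [J] is
     additive: if the bound fails on a box, it fails on one of its quarters. *)
  pose Q n x y := [/\ x1 <= x, x + w / 2 ^+ n <= x2, y1 <= y, y + h / 2 ^+ n <= y2 &
    2 * e * (w / 2 ^+ n + h / 2 ^+ n) ^+ 2 < `|J x (x + w / 2 ^+ n) y (y + h / 2 ^+ n)|].
  have [] := @nested_quadrants R w h Q x1 y1 w0 h0.
  - move=> n x y [Hx Hx' Hy Hy' HJ].
    have E2 : (2 ^+ n.+1 : R) != 0 by rewrite expf_neq0 // pnatr_eq0.
    have half (v : R) : v / 2 ^+ n = v / 2 ^+ n.+1 + v / 2 ^+ n.+1.
      by have : (2 ^+ n : R) != 0 by [rewrite expf_neq0 // pnatr_eq0]; rewrite exprS => ?; field.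
    have Hw : 0 <= w / 2 ^+ n.+1 by rewrite divr_ge0 // exprn_ge0.
    have Hh : 0 <= h / 2 ^+ n.+1 by rewrite divr_ge0 // exprn_ge0.
    move: HJ Hx' Hy'; rewrite /Q !half.
    move: (w / _) (h / _) Hw Hh => u v u0 v0 HJ Hx' Hy'.
    apply: contrapT => /forallNP nQ.
    have T a b : (a = x \/ a = x + u) -> (b = y \/ b = y + v) ->
        `|J a (a + u) b (b + v)| <= 2 * e * (u + v) ^+ 2.
      move=> Ha Hb; rewrite leNgt; apply/negP => HH.
      apply: (nQ a); exists b; split=> //; split=> //.
      - by case: Ha => -> //; rewrite (le_trans Hx) // lerDl.
      - by case: Ha => ->; rewrite -?addrA // (le_trans _ Hx') // lerD2l lerDl.
      - by case: Hb => -> //; rewrite (le_trans Hy) // lerDl.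
      - by case: Hb => ->; rewrite -?addrA // (le_trans _ Hy') // lerD2l lerDl.
    have := T x y (or_introl erefl) (or_introl erefl).
    have := T x (y + v) (or_introl erefl) (or_intror erefl).
    have := T (x + u) y (or_intror erefl) (or_introl erefl).
    have := T (x + u) (y + v) (or_intror erefl) (or_intror erefl).
    move: HJ; rewrite !addrA.
    have -> : J x (x + u + u) y (y + v + v) = J x (x + u) y (y + v)
        + J x (x + u) (y + v) (y + v + v) + J (x + u) (x + u + u) y (y + v)
        + J (x + u) (x + u + u) (y + v) (y + v + v) by rewrite /J; ring.
    have -> : u + u + v + v = (u + v) * 2 by ring.
    have -> : 2 * e * ((u + v) * 2) ^+ 2 = 4 * (2 * e * (u + v) ^+ 2) by ring.
    move: (2 * e * _) (J _ _ _ _) (J _ _ _ _) (J _ _ _ _) (J _ _ _ _) => t j4 j3 j2 j1.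
    have := ler_normD (j1 + j2 + j3) j4; have := ler_normD (j1 + j2) j3.
    by have := ler_normD j1 j2; lra.
  - have Ex : x1 + w = x2 by rewrite /w; ring.
    have Ey : y1 + h = y2 by rewrite /h; ring.
    by rewrite /Q expr0 !divr1 Ex Ey; split.
  move=> p [q Hpq].
  have [Hp Hq] : x1 <= p <= x2 /\ y1 <= q <= y2.
    by have [x [y [[Hx Hx' Hy Hy' _] [/andP[? ?] /andP[? ?]]]]] := Hpq 0%N; lra.
  have [a [k [b /(_ e e0)[d d0 Hd]]]] := loc p q Hp Hq.
  have [n wn] : exists n, w / 2 ^+ n + h / 2 ^+ n < d.
    have /= := @upper_nthrootP R ((w + h) / d) _ (leqnn _); move: (Num.bound _) => n Hn.
    by exists n; rewrite -mulrDl ltr_pdivrMr ?exprn_gt0 // -ltr_pdivrMl // mulrC.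
  have [x [y [[Hx Hx' Hy Hy' HJ] [/andP[px px'] /andP[qy qy']]]]] := Hpq n.
  have Hw : 0 <= w / 2 ^+ n by rewrite divr_ge0 // exprn_ge0.
  have Hh : 0 <= h / 2 ^+ n by rewrite divr_ge0 // exprn_ge0.
  move: (w / _) (h / _) Hw Hh wn Hx' Hy' HJ px' qy' => u v u0 v0 uv Hx' Hy' HJ px' qy'.
  have inX t : x <= t <= x + u -> x1 <= t <= x2.
    by case/andP=> h1 h2; rewrite (le_trans Hx h1) (le_trans h2 Hx').
  have inY t : y <= t <= y + v -> y1 <= t <= y2.
    by case/andP=> h1 h2; rewrite (le_trans Hy h1) (le_trans h2 Hy').
  have [xE yE] : x <= x <= x + u /\ y <= y <= y + v by rewrite !lexx !lerDl.
  have [xE' yE'] : x <= x + u <= x + u /\ y <= y + v <= y + v by rewrite !lexx !lerDl u0 v0.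
  have near x' y' : x <= x' <= x + u -> y <= y' <= y + v ->
      `|M x' y' - M p q - (a * (x' - p) + k * (y' - q))| <= e * (u + v) /\
      `|N x' y' - N p q - (k * (x' - p) + b * (y' - q))| <= e * (u + v).
    move=> Hx1 Hy1.
    have hu : `|x' - p| <= u by apply: dist_in_segment Hx1; rewrite px px'.
    have hv : `|y' - q| <= v by apply: dist_in_segment Hy1; rewrite qy qy'.
    have [||H1 H2] := Hd x' y'.
    - by apply: le_lt_trans hu (le_lt_trans _ uv); rewrite lerDl.
    - by apply: le_lt_trans hv (le_lt_trans _ uv); rewrite lerDr.
    have L : e * (`|x' - p| + `|y' - q|) <= e * (u + v).
      by rewrite ler_wpM2l ?(ltW e0) // lerD.
    by split; [exact: le_trans H1 L | exact: le_trans H2 L].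
  (* Up to the linearisation error, the horizontal sides contribute [- k * u * v] and the vertical
     ones [k * u * v]. They cancel because [M] and [N] share the cross derivative [k]. *)
  have T1 : `|(A (x + u) y - A x y) - (A (x + u) (y + v) - A x (y + v)) + k * v * u|
      <= 2 * (e * (u + v)) * u.
    apply: (@edge_difference _ (A ^~ y) (A ^~ (y + v)) (M ^~ y) (M ^~ (y + v))) => // t Ht.
    - by apply: dA; [exact: inX | exact: inY].
    - by apply: dA; [exact: inX | exact: inY].
    have -> : k * v = k * (y + v - q) - k * (y - q) by ring.
    exact: cancel_increment (near _ _ Ht yE).1 (near _ _ Ht yE').1.
  have T2 : `|(B (x + u) (y + v) - B (x + u) y) - (B x (y + v) - B x y) + (- (k * u)) * v|
      <= 2 * (e * (u + v)) * v.
    apply: (@edge_difference _ (B (x + u)) (B x) (N (x + u)) (N x)) => // t Ht.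
    - by apply: dB; [exact: inX | exact: inY].
    - by apply: dB; [exact: inX | exact: inY].
    have -> : - (k * u) = k * (x - p) - k * (x + u - p) by ring.
    have H1 := (near _ _ xE' Ht).2; have H2 := (near _ _ xE Ht).2.
    rewrite [k * _ + _]addrC in H1; rewrite [k * _ + _]addrC in H2.
    exact: cancel_increment H1 H2.
  move: HJ; apply/negP; rewrite -leNgt.
  have -> : J x (x + u) y (y + v) = (A (x + u) y - A x y - (A (x + u) (y + v) - A x (y + v)) + k * v * u) +
     (B (x + u) (y + v) - B (x + u) y - (B x (y + v) - B x y) + (- (k * u)) * v)
    by rewrite /J; ring.
  apply: (le_trans (ler_normD _ _)); apply: (le_trans (lerD T1 T2)).
  by rewrite le_eqVlt; apply/orP; left; apply/eqP; ring.
apply/eqP; rewrite -normr_eq0 eq_le normr_ge0 andbT.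
apply/ler_addgt0Pr => e e0; rewrite add0r.
(* The [+ 1] keeps the denominator positive when the rectangle degenerates to a point. *)
have c0 : 0 < 2 * (w + h) ^+ 2 + 1 by have := sqr_ge0 (w + h); lra.
have := small (e / (2 * (w + h) ^+ 2 + 1)) (divr_gt0 e0 c0) => /le_trans; apply.
have -> : 2 * (e / (2 * (w + h) ^+ 2 + 1)) * (w + h) ^+ 2 =
  e * (2 * (w + h) ^+ 2 / (2 * (w + h) ^+ 2 + 1)) by field; rewrite gt_eqF.
by rewrite ger_pMr // ler_pdivrMr //; lra.
Qed.

(** * Complex differentiability *)

Section Modulus.
Variable R : realType.
Implicit Types z w : R[i].

Lemma cabs_ge0 z : 0 <= cabs z.
Proof. by case: z => a b; rewrite /cabs /= sqrtr_ge0. Qed.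

Lemma cabs0 : cabs (0 : R[i]) = 0.
Proof. by rewrite /cabs Normc.normc0. Qed.

Lemma cabs1 : cabs (1 : R[i]) = 1.
Proof. by rewrite /cabs Normc.normc1. Qed.

Lemma cabs_eq0 z : (cabs z == 0) = (z == 0).
Proof.
apply/eqP/eqP => [/Normc.eq0_normc //|->]; exact: cabs0.
Qed.

Lemma cabs_gt0 z : (0 < cabs z) = (z != 0).
Proof. by rewrite lt_def cabs_ge0 andbT cabs_eq0. Qed.

Lemma cabsM z w : cabs (z * w) = cabs z * cabs w.
Proof. exact: Normc.normcM. Qed.

Lemma cabsV z : cabs z^-1 = (cabs z)^-1.
Proof. exact: Normc.normcV. Qed.

Lemma cabsD z w : cabs (z + w) <= cabs z + cabs w.
Proof. exact: le_normcD. Qed.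

Lemma cabsN z : cabs (- z) = cabs z.
Proof. exact: normcN. Qed.

Lemma cabsB z w : cabs (z - w) <= cabs z + cabs w.
Proof. by rewrite -[cabs w]cabsN cabsD. Qed.

Lemma cabs_distC z w : cabs (z - w) = cabs (w - z).
Proof. by rewrite -cabsN opprB. Qed.

Lemma cabs_dist2 z w : cabs z - cabs w <= cabs (z - w).
Proof. by have := cabsD (z - w) w; rewrite subrK; lra. Qed.

Lemma cabs_distD u z w : cabs (z - w) <= cabs (z - u) + cabs (u - w).
Proof. by rewrite (_ : z - w = (z - u) + (u - w)) ?cabsD // addrA subrK. Qed.

Lemma cabs_ball_sub z w (r : R) : cabs (w - z) < r - cabs z -> cabs w < r.
Proof. by have := cabs_distD z w 0; rewrite !subr0; lra. Qed.

Lemma cabsX z n : cabs (z ^+ n) = cabs z ^+ n.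
Proof. by elim: n => [|n IH]; rewrite ?expr0 ?cabs1 // !exprS cabsM IH. Qed.

Lemma sqr_cabs z : cabs z ^+ 2 = complex.Re z ^+ 2 + complex.Im z ^+ 2.
Proof. by case: z => a b; rewrite /cabs /= sqr_sqrtr // addr_ge0 // sqr_ge0. Qed.

Lemma Re_le_cabs z : `|complex.Re z| <= cabs z.
Proof.
rewrite -[leLHS]ger0_norm // -[leRHS]ger0_norm ?cabs_ge0 // -ler_sqr ?nnegrE //.
by rewrite !real_normK ?num_real // sqr_cabs lerDl sqr_ge0.
Qed.

Lemma Im_le_cabs z : `|complex.Im z| <= cabs z.
Proof.
rewrite -[leLHS]ger0_norm // -[leRHS]ger0_norm ?cabs_ge0 // -ler_sqr ?nnegrE //.
by rewrite !real_normK ?num_real // sqr_cabs lerDr sqr_ge0.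
Qed.

Lemma cabs_real (r : R) : cabs (r%:C)%C = `|r|.
Proof. by rewrite /cabs /= expr0n /= addr0 sqrtr_sqr. Qed.

Lemma cabs_le_ReIm z : cabs z <= `|complex.Re z| + `|complex.Im z|.
Proof.
rewrite {1}[z]complexE; apply: (le_trans (cabsD _ _)); rewrite cabsM !cabs_real.
by rewrite {1}/cabs /= expr0n /= expr1n add0r sqrtr1 mul1r.
Qed.

Lemma cabs_conj z : cabs (conjc z) = cabs z.
Proof. by case: z => a b; rewrite /cabs /= sqrrN. Qed.

Lemma mulc_conj z : z * conjc z = ((cabs z ^+ 2)%:C)%C.
Proof.
rewrite sqr_cabs; case: z => a b; apply/eqP; rewrite eq_complex /=.
by apply/andP; split; apply/eqP; ring.
Qed.

End Modulus.

Section ComplexDiff.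
Variable R : realType.
Implicit Types (f g : R[i] -> R[i]) (z w : R[i]).

Definition cnear z (P : R[i] -> Prop) : Prop :=
  exists2 r : R, 0 < r & forall w, cabs (w - z) < r -> P w.

Definition ccont f z : Prop :=
  forall e : R, 0 < e -> cnear z (fun w => cabs (f w - f z) <= e).

(* Caratheodory's form of complex differentiability: [q] is the difference quotient, extended continuously to [z]. *)
Definition cdiff f z : Prop :=
  exists2 q, ccont q z & cnear z (fun w => f w - f z = q w * (w - z)).

Lemma cnear_imp z (P Q : R[i] -> Prop) :
  (forall w, P w -> Q w) -> cnear z P -> cnear z Q.
Proof. by move=> PQ [r r0 H]; exists r => // w /H /PQ. Qed.

Lemma cnearI z (P Q : R[i] -> Prop) :
  cnear z P -> cnear z Q -> cnear z (fun w => P w /\ Q w).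
Proof.
move=> [r r0 Hr] [t t0 Ht]; exists (Num.min r t); first by rewrite lt_min r0.
by move=> w; rewrite lt_min => /andP[/Hr ? /Ht].
Qed.

Lemma cnear_at z (P : R[i] -> Prop) : cnear z P -> P z.
Proof. by move=> [r r0]; apply; rewrite subrr cabs0. Qed.

Lemma cnear_ball z (r : R) : 0 < r -> cnear z (fun w => cabs (w - z) < r).
Proof. by move=> r0; exists r. Qed.

Lemma ccont_near f g z : cnear z (fun w => f w = g w) -> ccont f z -> ccont g z.
Proof.
move=> E cf e /cf H; apply: cnear_imp (cnearI E H) => w [<-].
by rewrite -(cnear_at E).
Qed.

Lemma ccont_cst c z : ccont (fun=> c) z.
Proof. by move=> e e0; exists 1 => // w _; rewrite subrr cabs0 ltW. Qed.

Lemma ccont_id z : ccont id z.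
Proof. by move=> e e0; exists e => // w /ltW. Qed.

Lemma ccontD f g z : ccont f z -> ccont g z -> ccont (fun w => f w + g w) z.
Proof.
move=> cf cg e e0; have e2 : 0 < e / 2 by rewrite divr_gt0.
apply: cnear_imp (cnearI (cf _ e2) (cg _ e2)) => w [Hf Hg].
rewrite (_ : _ - _ = (f w - f z) + (g w - g z)); last by ring.
by apply: le_trans (cabsD _ _) _; lra.
Qed.

Lemma ccontM f g z : ccont f z -> ccont g z -> ccont (fun w => f w * g w) z.
Proof.
move=> cf cg e e0; pose K := cabs (f z) + cabs (g z) + 1.
have K0 : 0 < K by have := cabs_ge0 (f z); have := cabs_ge0 (g z); rewrite /K; lra.
have e2 : 0 < Num.min 1 (e / (2 * K)).
  by rewrite lt_min ltr01 divr_gt0 // mulr_gt0.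
apply: cnear_imp (cnearI (cf _ e2) (cg _ e2)) => w [].
rewrite !le_min => /andP[_ Hf] /andP[Hg1 Hg].
rewrite (_ : _ - _ = (f w - f z) * g w + f z * (g w - g z)); last by ring.
apply: le_trans (cabsD _ _) _; rewrite !cabsM.
have Hgw : cabs (g w) <= K.
  have := cabs_dist2 (g w) (g z); have := cabs_ge0 (f z); rewrite /K; lra.
have HfK : cabs (f z) <= K by have := cabs_ge0 (g z); rewrite /K; lra.
have -> : e = e / (2 * K) * K + K * (e / (2 * K)) by field; rewrite gt_eqF.
by apply: lerD; apply: ler_pM; rewrite ?cabs_ge0.
Qed.

Lemma ccontV f z : f z != 0 -> ccont f z -> ccont (fun w => (f w)^-1) z.
Proof.
rewrite -cabs_gt0 => fz0 cf e e0; pose a := cabs (f z).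
have e2 : 0 < Num.min (a / 2) (e * a ^+ 2 / 2).
  by rewrite lt_min !divr_gt0 // mulr_gt0 // exprn_gt0.
apply: cnear_imp (cf _ e2) => w; rewrite le_min => /andP[H1 H2].
have fw : a / 2 <= cabs (f w).
  by have := cabs_dist2 (f z) (f w); rewrite cabs_distC -/a; lra.
have fw0 : 0 < cabs (f w) by apply: lt_le_trans fw; rewrite divr_gt0.
have -> : (f w)^-1 - (f z)^-1 = (f z - f w) / (f w * f z).
  by field; rewrite -!cabs_gt0 fz0 fw0.
rewrite !cabsM cabsV cabsM cabs_distC ler_pdivrMr ?mulr_gt0 //.
apply: (le_trans H2); rewrite -mulrA ler_pM2l // expr2 -/a.
have -> : a * a / 2 = a / 2 * a by ring.
by rewrite ler_pM2r.
Qed.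

Lemma ccontN f z : ccont f z -> ccont (fun w => - f w) z.
Proof.
move=> cf e /cf; apply: cnear_imp => w.
by rewrite -opprD cabsN.
Qed.

Lemma ccontB f g z : ccont f z -> ccont g z -> ccont (fun w => f w - g w) z.
Proof. by move=> cf cg; apply: ccontD => //; exact: ccontN. Qed.

Lemma ccont_neq0 f z : ccont f z -> f z != 0 -> cnear z (fun w => f w != 0).
Proof.
move=> cf; rewrite -cabs_gt0 => f0.
have := cf (cabs (f z) / 2); rewrite divr_gt0 // => /(_ isT).
apply: cnear_imp => w H; rewrite -cabs_gt0.
by have := cabs_dist2 (f z) (f w); rewrite cabs_distC; lra.
Qed.

Lemma cdiff_near f g z : cnear z (fun w => f w = g w) -> cdiff f z -> cdiff g z.
Proof.
move=> E [q cq H]; exists q => //; apply: cnear_imp (cnearI E H) => w [<-].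
by rewrite -(cnear_at E).
Qed.

Lemma cdiff_cont f z : cdiff f z -> ccont f z.
Proof.
move=> [q cq H]; apply: (@ccont_near (fun w => f z + q w * (w - z))).
  by apply: cnear_imp H => w <-; rewrite addrC subrK.
apply: ccontD (ccont_cst _ _) _; apply: ccontM => //.
by apply: ccontB (ccont_cst _ _); exact: ccont_id.
Qed.

Lemma cdiff_cst c z : cdiff (fun=> c) z.
Proof.
exists (fun=> 0); first exact: ccont_cst.
by exists 1 => // w _; rewrite subrr mul0r.
Qed.

Lemma cdiff_id z : cdiff id z.
Proof.
by exists (fun=> 1); [exact: ccont_cst | exists 1 => // w _; rewrite mul1r].
Qed.

Lemma cdiffD f g z : cdiff f z -> cdiff g z -> cdiff (fun w => f w + g w) z.
Proof.
move=> [q cq Hq] [p cp Hp]; exists (fun w => q w + p w); first exact: ccontD.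
by apply: cnear_imp (cnearI Hq Hp) => w [E1 E2]; rewrite mulrDl -E1 -E2; ring.
Qed.

Lemma cdiffM f g z : cdiff f z -> cdiff g z -> cdiff (fun w => f w * g w) z.
Proof.
move=> df dg; have cg := cdiff_cont dg; move: df dg => [q cq Hq] [p cp Hp].
exists (fun w => q w * g w + f z * p w).
  by apply: ccontD; apply: ccontM => //; exact: ccont_cst.
apply: cnear_imp (cnearI Hq Hp) => w [E1 E2].
rewrite mulrDl mulrAC -E1 -mulrA -E2; ring.
Qed.

Lemma cdiffB f g z : cdiff f z -> cdiff g z -> cdiff (fun w => f w - g w) z.
Proof.
move=> df dg; apply: (@cdiff_near (fun w => f w + (-1) * g w)).
  by exists 1 => // w _; rewrite mulN1r.
by apply: cdiffD => //; apply: cdiffM => //; exact: cdiff_cst.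
Qed.

Lemma cdiffV f z : f z != 0 -> cdiff f z -> cdiff (fun w => (f w)^-1) z.
Proof.
move=> fz0 df; have cf := cdiff_cont df; case: df => q cq Hq.
exists (fun w => - q w * ((f w)^-1 * (f z)^-1)).
  apply: ccontM; first exact: ccontN.
  by apply: ccontM (ccont_cst _ _); exact: ccontV.
apply: cnear_imp (cnearI Hq (ccont_neq0 cf fz0)) => w [E fw0].
rewrite mulrAC mulNr -E; field; by rewrite fz0.
Qed.

Lemma cdiff_quotient f a z : z != a -> cdiff f z ->
  cdiff (fun w => (f w - f a) / (w - a)) z.
Proof.
move=> za df; apply: cdiffM; first by apply: cdiffB => //; exact: cdiff_cst.
apply: cdiffV; first by rewrite subr_eq0.
by apply: cdiffB; [exact: cdiff_id | exact: cdiff_cst].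
Qed.

End ComplexDiff.

(** * Exponential polar coordinates and the mean value property *)

Lemma is_derive_eps (R : realType) (f : R -> R) (x d : R) : is_derive x 1 f d ->
  forall e : R, 0 < e -> exists2 r : R, 0 < r &
    forall y, `|y| < r -> `|f (x + y) - f x - d * y| <= e * `|y|.
Proof.
move=> [df <-] e e0.
have /cvgrPdist_le /(_ _ e0) := df.
rewrite /dnbhs near_withinE => /nbhs_ballP [r /= r0 H].
exists r => // y yr; have [->|y0] := eqVneq y 0.
  by rewrite addr0 subrr mulr0 subrr !normr0 mulr0.
have {H} := H y; rewrite /ball /= sub0r normrN yr => /(_ isT y0).
rewrite -/(derive f x 1) => H.
rewrite distrC -ler_pdivrMr ?normr_gt0 // -normfV -normrM.
move: H; rewrite (_ : _ - _ = ('D_1 f x * y - (f (x + y) - f x)) / y) //.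
rewrite mulrBl mulfK //; congr (_ - _).
by rewrite /GRing.scale /= mulr1 [y + x]addrC mulrC.
Qed.

Lemma min_lipschitz (R : realType) (c x y : R) :
  `|Num.min x c - Num.min y c| <= `|x - y|.
Proof.
have N1 := ler_norm (x - y); have := ler_norm (y - x); rewrite distrC => N2.
rewrite ler_norml; apply/andP.
by have [?|?] := leP x c; have [?|?] := leP y c; split; lra.
Qed.

Section MeanValue.
Variable R : realType.
Implicit Types (f : R[i] -> R[i]) (s z w : R[i]) (x y t : R).

Definition cexp x y : R[i] := Complex (expR x * cos y) (expR x * sin y).

Lemma cexpD x y x' y' : cexp (x + x') (y + y') = cexp x y * cexp x' y'.
Proof.
apply/eqP; rewrite eq_complex /= expRD cosD sinD.
by apply/andP; split; apply/eqP; ring.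
Qed.

Lemma cabs_cexp x y : cabs (cexp x y) = expR x.
Proof.
rewrite -[RHS]ger0_norm ?expR_ge0 // -[LHS]ger0_norm ?cabs_ge0 //.
apply/eqP; rewrite -(@eqrXn2 _ 2) ?normr_ge0 // !real_normK ?num_real //.
by rewrite sqr_cabs /= !exprMn -mulrDr cos2Dsin2 mulr1.
Qed.

Lemma cexp_periodic x y : cexp x (y + pi *+ 2) = cexp x y.
Proof. by rewrite /cexp cosD2pi sinD2pi. Qed.

(** The expansion at 0 is enough: [cexpD] carries it to every other point. *)
Lemma cexp_linear (e : R) : 0 < e -> exists2 d : R, 0 < d & forall x y, `|x| < d -> `|y| < d ->
  cabs (cexp x y - 1 - Complex x y) <= e * (`|x| + `|y|).
Proof.
move=> e0; have [h [h0 h1 h6]] : exists h : R, [/\ 0 < h, h <= 1 & h <= e / 8].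
  exists (Num.min 1 (e / 8)).
  by rewrite lt_min ltr01 divr_gt0 // !ge_min !lexx orbT.
have [d1 d10 H1] := @is_derive_eps R _ 0 _ (is_derive_expR 0) h h0.
have [d2 d20 H2] := @is_derive_eps R _ 0 _ (is_derive_cos 0) h h0.
have [d3 d30 H3] := @is_derive_eps R _ 0 _ (is_derive_sin 0) h h0.
exists (Num.min (Num.min d1 d2) (Num.min d3 h)); first by rewrite !lt_min d10 d20 d30.
move=> x y; rewrite !lt_min => /andP[/andP[X1 X2] /andP[X3 X4]] /andP[/andP[Y1 Y2] /andP[Y3 Y4]].
move: (H1 x X1) (H2 y Y2) (H3 y Y3) => {H1 H2 H3}.
rewrite !add0r expR0 sin0 cos0 !(oppr0, mul0r, addr0, mul1r).
move=> A1 A2 A3; apply: (le_trans (cabs_le_ReIm _)); rewrite /=.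
set a := expR x - 1 in A1; set c := cos y - 1 in A2; set b := sin y in A3 *.
have -> : expR x * cos y - 1 - x = (a - x) + c * (1 + a) by rewrite /a /c; ring.
have -> : expR x * b + - 0 - y = (b - y) + a * b by rewrite /a; ring.
have nx := normr_ge0 x; have ny := normr_ge0 y.
have hx : h * `|x| <= `|x| by rewrite ler_piMl.
have hy : h * `|y| <= `|y| by rewrite ler_piMl.
have A4 : `|a| <= 2 * `|x|.
  have -> : a = (a - x) + x by ring.
  by apply: le_trans (ler_normD _ _) _; lra.
have A5 : `|b| <= 2 * `|y|.
  have -> : b = (b - y) + y by ring.
  by apply: le_trans (ler_normD _ _) _; lra.
have A6 : `|a * b| <= 4 * h * `|y|.
  rewrite normrM (le_trans (ler_pM (normr_ge0 _) (normr_ge0 _) A4 A5)) //.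
  have : `|x| * `|y| <= h * `|y| by rewrite ler_wpM2r // ltW.
  lra.
have A7 : `|c * (1 + a)| <= 3 * (h * `|y|).
  have A8 : `|1 + a| <= 3 by apply: le_trans (ler_normD _ _) _; rewrite normr1; lra.
  by rewrite normrM mulrC ler_pM.
have N1 := ler_normD (a - x) (c * (1 + a)).
have N2 := ler_normD (b - y) (a * b).
have E1 : h * `|x| <= e / 8 * `|x| by rewrite ler_wpM2r.
have E2 : h * `|y| <= e / 8 * `|y| by rewrite ler_wpM2r.
have E3 := mulr_ge0 (ltW e0) nx.
lra.
Qed.

(* Cauchy--Riemann in logarithmic polar coordinates [w = s + exp (x + i y)]. *)
Lemma cdiff_polar f s x y : cdiff f (s + cexp x y) ->
  exists a b : R, forall e : R, 0 < e -> exists2 d : R, 0 < d & forall x' y',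
    `|x' - x| < d -> `|y' - y| < d ->
    cabs (f (s + cexp x' y') - f (s + cexp x y) - Complex a b * Complex (x' - x) (y' - y))
      <= e * (`|x' - x| + `|y' - y|).
Proof.
move=> [q cq [r r0 Hq]].
(* [D] is given by the chain rule: the derivative of [f] at [p] times that of the exponential, which
   is [W] itself. *)
pose W := cexp x y; pose p := s + W; pose D := q p * W.
exists (complex.Re D), (complex.Im D) => e e0.
have -> : Complex (complex.Re D) (complex.Im D) = D by case: (D).
pose M := 4 * (cabs W + cabs D + 1).
have [W0 D0] := (cabs_ge0 W, cabs_ge0 D).
have M0 : 0 < M by rewrite /M; lra.
pose e1 := Num.min 1 (e / M).
have e10 : 0 < e1 by rewrite lt_min ltr01 divr_gt0.
have [e11 e1e] : e1 <= 1 /\ e1 * M <= e.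
  by rewrite /e1; split; rewrite -?ler_pdivlMr // ge_min lexx ?orbT.
have [d1 d10 H1] := cexp_linear e10.
have [r2 r20 Hc] := cq e1 e10.
pose d := Num.min d1 (Num.min (r / M) (r2 / M)).
have d0 : 0 < d by rewrite !lt_min d10 !divr_gt0.
exists d => // x' y'.
have -> : x' = x + (x' - x) by ring.
have -> : y' = y + (y' - y) by ring.
move: (x' - x) (y' - y) => u v; rewrite ![_ + u - _]addrAC ![_ + v - _]addrAC !subrr !add0r.
rewrite !lt_min => /andP[u1 /andP[u2 u3]] /andP[v1 /andP[v2 v3]].
have {}H1 := H1 u v u1 v1.
have nu := normr_ge0 u; have nv := normr_ge0 v.
set n := `|u| + `|v| in H1 *.
have n0 : 0 <= n by rewrite addr_ge0.
have cuv : cabs (Complex u v) <= n by exact: (cabs_le_ReIm (Complex u v)).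
have E1 : cabs (cexp u v - 1) <= 2 * n.
  have -> : cexp u v - 1 = (cexp u v - 1 - Complex u v) + Complex u v by ring.
  have : e1 * n <= n by rewrite ler_piMl.
  by have := cabsD (cexp u v - 1 - Complex u v) (Complex u v); lra.
rewrite cexpD -/W.
have near (k : R) : `|u| < k / M -> `|v| < k / M -> cabs (s + W * cexp u v - p) < k.
  move=> uk vk; have -> : s + W * cexp u v - p = W * (cexp u v - 1) by rewrite /p; ring.
  rewrite cabsM; apply: (@le_lt_trans _ _ (cabs W * (2 * n))).
    by rewrite ler_wpM2l.
  apply: (@le_lt_trans _ _ (n * (M / 2))); first by rewrite /M; nra.
  rewrite -ltr_pdivlMr ?divr_gt0 //.
  have -> : k / (M / 2) = k / M + k / M by field; rewrite gt_eqF.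
  by rewrite /n; lra.
have {}Hq := Hq _ (near r u2 v2).
have {}Hc := Hc _ (near r2 u3 v3).
rewrite -/p Hq.
have -> : s + W * cexp u v - p = W * (cexp u v - 1) by rewrite /p; ring.
set Q := q (s + _) in Hc *.
have -> : Q * (W * (cexp u v - 1)) - D * Complex u v =
   (Q - q p) * W * (cexp u v - 1) + D * (cexp u v - 1 - Complex u v).
  by rewrite /D; ring.
apply: (le_trans (cabsD _ _)); rewrite 3!cabsM.
have T1 : cabs (Q - q p) * cabs W * cabs (cexp u v - 1) <= e1 * cabs W * (2 * n).
  by apply: ler_pM; rewrite ?mulr_ge0 ?cabs_ge0 // ler_wpM2r.
have T2 : cabs D * cabs (cexp u v - 1 - Complex u v) <= cabs D * (e1 * n).
  by rewrite ler_wpM2l.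
apply: (le_trans (lerD T1 T2)).
have T3 : e1 * M * n <= e * n by rewrite ler_wpM2r.
apply: le_trans T3; rewrite /M.
have E0 := ltW e10; have P1 := mulr_ge0 (mulr_ge0 E0 W0) n0.
have P2 := mulr_ge0 (mulr_ge0 E0 D0) n0; have P3 := mulr_ge0 E0 n0.
lra.
Qed.

(* The mean of [f] over the circle of radius [exp x] does not depend on [x] by Green's formula on
   [x1, ln rho] x [0, 2 pi], whose horizontal sides cancel; it tends to [f s] as [x1 -> -oo]. *)
Lemma circle_mean_value f s (r rho : R) :
  ccont f s -> (forall z, 0 < cabs (z - s) < r -> cdiff f z) -> 0 < rho < r ->
  exists2 z, cabs (z - s) = rho & complex.Re (f z) = complex.Re (f s).
Proof.
move=> cf df /andP[rho0 rhor].
have r0 : 0 < r := lt_trans rho0 rhor.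
pose L := ln rho; pose X := ln r; pose L' := (L + X) / 2.
have LX : L < X by rewrite /L /X ltr_ln ?posrE.
have [LL' L'X] : L < L' /\ L' < X by rewrite /L'; lra.
pose u x y := complex.Re (f (s + cexp x y)); pose v x y := complex.Im (f (s + cexp x y)).
have cd x y : x < X -> cdiff f (s + cexp x y).
  move=> xX; apply: df; rewrite addrAC subrr add0r cabs_cexp expR_gt0 /=.
  by rewrite -[ltRHS](@lnK R) ?posrE // ltr_expR.
have cont x y (e : R) : x < X -> 0 < e -> exists2 d : R, 0 < d &
    forall x' y', `|x' - x| < d -> `|y' - y| < d ->
      `|u x' y' - u x y| <= e /\ `|v x' y' - v x y| <= e.
  move=> xX e0; have [a [b /(_ 1 ltr01)[d d0 H]]] := cdiff_polar (cd x y xX).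
  pose K := cabs (Complex a b) + 1.
  have K0 : 0 < K by have := cabs_ge0 (Complex a b); rewrite /K; lra.
  exists (Num.min d (e / (2 * K))); first by rewrite lt_min d0 divr_gt0 // mulr_gt0.
  move=> x' y'; rewrite !lt_min => /andP[X1 X2] /andP[Y1 Y2].
  have {}H := H x' y' X1 Y1.
  suff HG : cabs (f (s + cexp x' y') - f (s + cexp x y)) <= e.
    split; apply: le_trans HG; rewrite /u /v.
      by rewrite -raddfB; exact: Re_le_cabs.
    by rewrite -raddfB; exact: Im_le_cabs.
  have N := cabs_le_ReIm (Complex (x' - x) (y' - y)); rewrite /= in N.
  have T := cabsD (f (s + cexp x' y') - f (s + cexp x y) - Complex a b * Complex (x' - x) (y' - y))
    (Complex a b * Complex (x' - x) (y' - y)).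
  rewrite subrK cabsM in T.
  set n := `|x' - x| + `|y' - y| in H N.
  have nK : n <= e / K.
    have -> : e / K = e / (2 * K) + e / (2 * K) by field; rewrite gt_eqF.
    by rewrite /n; lra.
  have : cabs (Complex a b) * cabs (Complex (x' - x) (y' - y)) <= cabs (Complex a b) * n.
    by rewrite ler_wpM2l // cabs_ge0.
  have : n * K <= e by rewrite -ler_pdivlMr.
  by rewrite /K; lra.
(* Truncation at [L'] makes the integrand continuous on the whole line, as [primitive_exists]
   requires, though [v] is controlled only for [x < X]. Since [L < L'], nothing changes near the
   rectangle. *)
pose M x y := v (Num.min x L') y.
have Mc y : continuous (M ^~ y).
  apply: continuous_of_eps => x e e0.
  have xm : Num.min x L' < X by rewrite gt_min L'X orbT.
  have [d d0 H] := cont _ y e xm e0; exists d => // x' xd.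
  apply: (H _ _ _ _).2; rewrite ?subrr ?normr0 //; apply: le_lt_trans xd; exact: min_lipschitz.
have uc x : x < X -> continuous (u x).
  move=> xX; apply: continuous_of_eps => y e e0.
  have [d d0 H] := cont x y e xX e0; exists d => // y' yd.
  by apply: (H _ _ _ _).1; rewrite ?subrr ?normr0.
(* Primitives are chosen once, as a function of base point and integrand. Equal integrands thus
   receive the same primitive, and periodicity in [y] makes the horizontal sides cancel. *)
have /choice[P HP] : forall ah : R * (R -> R), exists H : R -> R,
    continuous ah.2 -> forall x, ah.1 < x -> is_derive x 1 H (ah.2 x).
  move=> [a h] /=; have [/(primitive_exists a)[H HH]|nc] := pselect (continuous h).
    by exists H.
  by exists h.
have pi2 : 0 < pi *+ 2 :> R by rewrite pmulrn_rgt0 // pi_gt0.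
pose B x := P (-1, u x).
have dB x y : x <= L -> 0 <= y -> is_derive y 1 (B x) (u x y).
  by move=> xL y0; apply: (HP (-1, u x)) => /=; [apply: uc|]; lra.
have mean x : x <= L -> exists2 c, B x (pi *+ 2) - B x 0 = u x c * (pi *+ 2) & True.
  move=> xL; have [|t /andP[t0 _]|c _ E] := @MVT_le R (B x) (u x) 0 (pi *+ 2).
  - exact: ltW.
  - exact: dB.
  by exists c; rewrite // E subr0.
have green x1 : x1 <= L -> B L (pi *+ 2) - B L 0 = B x1 (pi *+ 2) - B x1 0.
  move=> x1L.
  pose A x y := P (x1 - 1, M ^~ y) x.
  have AE x : A x (pi *+ 2) = A x 0.
    rewrite /A (_ : M ^~ (pi *+ 2) = M ^~ 0) //; apply: funext => t.
    by rewrite /M /v -{1}[pi *+ 2]add0r cexp_periodic.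
  have := @green_rect R M u A B x1 L 0 (pi *+ 2) x1L (ltW pi2).
  rewrite !AE => E; suff : A L 0 - A x1 0 + (B L (pi *+ 2) - B L 0) - (A L 0 - A x1 0)
      - (B x1 (pi *+ 2) - B x1 0) = 0 by lra.
  apply: E.
  - move=> x y Hx _; apply: (HP (x1 - 1, M ^~ y)); first exact: Mc.
    by rewrite /=; lra.
  - by move=> x y /andP[_ xL] /andP[y0 _]; exact: dB.
  move=> p q /andP[_ pL] _.
  have pX : p < X by lra.
  have [a [b H]] := cdiff_polar (cd p q pX).
  (* Cauchy--Riemann: multiplication by [a + i b] gives [v] the gradient [(b, a)] and [u] the
     gradient [(a, -b)], so the form [v dx + u dy] is closed with cross derivative [a]. *)
  exists b, a, (- b) => e e0; have [d d0 {}H] := H e e0.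
  exists (Num.min d (L' - L)); first by rewrite lt_min d0 subr_gt0.
  move=> x y; rewrite !lt_min => /andP[xd xL] /andP[yd _].
  have xm : Num.min x L' = x.
    by apply/min_idPl; move: xL; rewrite ltr_norml; lra.
  have pm : Num.min p L' = p by apply/min_idPl; lra.
  have {}H := H x y xd yd; rewrite /M /u /v xm pm; split; apply: le_trans H.
    apply: le_trans (Im_le_cabs _); rewrite !raddfB /= le_eqVlt; apply/orP; left.
    by apply/eqP; congr (`| _ |); ring.
  apply: le_trans (Re_le_cabs _); rewrite !raddfB /= le_eqVlt; apply/orP; left.
  by apply/eqP; congr (`| _ |); ring.
have [c Ec _] := mean L (lexx _).
exists (s + cexp L c).
  by rewrite addrAC subrr add0r cabs_cexp lnK ?posrE.
apply/eqP; rewrite -subr_eq0 -normr_eq0 eq_le normr_ge0 andbT.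
apply/ler_addgt0Pr => e e0; rewrite add0r.
have [d d0 H] := cf e e0.
(* The circle of radius [expR x1] lies where [f] differs from [f s] by at most [e]. *)
pose x1 := Num.min L (ln (d / 2)).
have x1L : x1 <= L by rewrite ge_min lexx.
have x1d : expR x1 < d.
  have d2 : 0 < d / 2 by rewrite divr_gt0.
  apply: (@le_lt_trans _ _ (d / 2)); last by lra.
  by rewrite -[leRHS](@lnK R) ?posrE // ler_expR ge_min lexx orbT.
have [c' Ec' _] := mean x1 x1L.
have /(mulIf (lt0r_neq0 pi2)) E : u L c * (pi *+ 2) = u x1 c' * (pi *+ 2).
  by rewrite -Ec -Ec' (green x1).
rewrite -/(u L c) E /u -raddfB; apply: le_trans (Re_le_cabs _) _.
by apply: H; rewrite addrAC subrr add0r cabs_cexp.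
Qed.

End MeanValue.

(** * Maximum principle and isolation of zeros *)

Section DiscFacts.
Variable R : realType.
Implicit Types (f g : R[i] -> R[i]) (a s z w : R[i]) (r rho : R).

Lemma continuous_Complex (psi : R[i] -> R) (p : R * R) :
  (forall e : R, 0 < e -> cnear (Complex p.1 p.2) (fun w => `|psi w - psi (Complex p.1 p.2)| <= e)) ->
  {for p, continuous (fun q : R * R => psi (Complex q.1 q.2))}.
Proof.
move=> H; apply/cvgrPdist_le => e e0; have [r r0 {}H] := H e e0.
have r2 : 0 < r / 2 by rewrite divr_gt0.
exists (ball p.1 (r / 2), ball p.2 (r / 2)); first by split; exact: nbhsx_ballx.
move=> q; rewrite /ball /= => -[B1 B2]; rewrite distrC; apply: H.
apply: le_lt_trans (cabs_le_ReIm _) _; rewrite /=.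
by rewrite distrC in B1; rewrite distrC in B2; lra.
Qed.

(** Taking [S] to be the half-line up to [rho] gives a closed disc, and taking it to be the
    singleton of [rho] gives a circle. *)
Lemma compact_cabs (S : set R) (rho : R) : closed S -> (forall x, S x -> x <= rho) ->
  compact [set p : R * R | S (cabs (Complex p.1 p.2))].
Proof.
move=> cS Sr.
have cB : compact (`[-rho, rho] `*` `[-rho, rho] : set (R * R)).
  by apply: compact_setX; exact: segment_compact.
apply: (subclosed_compact _ cB).
  rewrite (_ : mkset _ = (fun p : R * R => cabs (Complex p.1 p.2)) @^-1` S) //.
  apply: closed_comp cS => p _; apply: continuous_Complex => e e0; exists e => // w wp.
  rewrite ler_norml; apply/andP.
  have := cabs_dist2 w (Complex p.1 p.2); have := cabs_dist2 (Complex p.1 p.2) w.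
  by rewrite [cabs (_ - w)]cabs_distC; split; lra.
move=> p /= /Sr Hp; have := Re_le_cabs (Complex p.1 p.2); have := Im_le_cabs (Complex p.1 p.2).
by rewrite /= !in_itv /= -!ler_norml => *; split; apply: le_trans Hp.
Qed.

Lemma disc_max (phi : R[i] -> R) a rho : 0 <= rho ->
  (forall z, cabs (z - a) <= rho -> forall e : R, 0 < e ->
     cnear z (fun w => `|phi w - phi z| <= e)) ->
  exists2 c, cabs (c - a) <= rho & forall z, cabs (z - a) <= rho -> phi z <= phi c.
Proof.
move=> rho0 cphi.
pose K := [set p : R * R | cabs (Complex p.1 p.2) <= rho].
have cK : compact K by exact: (@compact_cabs _ rho (@closed_le _ rho) (fun x H => H)).
have K0 : K !=set0.
  by exists (0, 0); have : cabs (0 : R[i]) <= rho; [rewrite cabs0 | exact].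
pose h (p : R * R) := phi (a + Complex p.1 p.2).
have [|c Kc H] := @compact_EVT_max _ R h K K0 cK.
  apply: continuous_in_subspaceT => p; rewrite inE => Kp.
  apply: (@continuous_Complex (fun w => phi (a + w))) => e e0.
  have [|r r0 Hr] := cphi (a + Complex p.1 p.2) _ e e0.
    by rewrite addrAC subrr add0r.
  by exists r => // w wp; apply: Hr; rewrite opprD addrACA subrr add0r.
exists (a + Complex c.1 c.2); first by rewrite addrAC subrr add0r; rewrite inE in Kc.
move=> z za; have E : z = a + Complex (complex.Re (z - a)) (complex.Im (z - a)).
  by case: (z - a) (subrK a z) => x y /= <-; rewrite addrC.
rewrite {1}E; apply: (H (_, _)); rewrite inE /K /=.
by case: (z - a) za.
Qed.

(** Differentiability is asked on punctured neighbourhoods, together with continuity, so that the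
    principle applies to difference quotients extended over their singular point. A value above [M]
    would give a penalised square modulus an interior maximum [s], which the mean value property
    contradicts on a small circle around [s]. *)
Lemma maximum_modulus f a rho (M : R) : 0 < rho ->
  (forall z, cabs (z - a) <= rho -> ccont f z) ->
  (forall s, cabs (s - a) < rho -> exists2 r : R, 0 < r &
     forall z, 0 < cabs (z - s) < r -> cdiff f z) ->
  (forall z, cabs (z - a) = rho -> cabs (f z) <= M) ->
  forall z, cabs (z - a) <= rho -> cabs (f z) <= M.
Proof.
move=> rho0 cf df bd z0 z0a; rewrite leNgt; apply/negP => big.
have M0 : 0 <= M.
  have /bd : cabs ((a + (rho%:C)%C) - a) = rho.
    by rewrite addrAC subrr add0r cabs_real ger0_norm // ltW.
  by apply: le_trans; exact: cabs_ge0.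
(* The penalty on the boundary is half the gap, too small for the maximum to lie there. *)
pose eps := (cabs (f z0) ^+ 2 - M ^+ 2) / (2 * rho ^+ 2).
have r2 : 0 < 2 * rho ^+ 2 by rewrite mulr_gt0 // exprn_gt0.
have gap : 0 < cabs (f z0) ^+ 2 - M ^+ 2 by rewrite subr_gt0 ltr_sqr ?nnegrE ?cabs_ge0.
have eps0 : 0 < eps by rewrite divr_gt0.
have epsE : eps * rho ^+ 2 < cabs (f z0) ^+ 2 - M ^+ 2.
  have -> : eps * rho ^+ 2 = (cabs (f z0) ^+ 2 - M ^+ 2) / 2.
    by rewrite /eps; field; rewrite gt_eqF.
  lra.
(* the penalty [eps |z - a|^2] makes the maximum strict along small circles *)
pose phi z := cabs (f z) ^+ 2 + eps * cabs (z - a) ^+ 2.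
pose F z := f z * conjc (f z) + (eps%:C)%C * ((z - a) * conjc (z - a)).
have phiE z : F z = ((phi z)%:C)%C by rewrite /F !mulc_conj -rmorphM -rmorphD.
have conj_cont g z : ccont g z -> ccont (fun w => conjc (g w)) z.
  by move=> cg e /cg; apply: cnear_imp => w; rewrite -rmorphB cabs_conj.
have cid z : ccont (fun w => w - a) z.
  by apply: ccontB (ccont_cst _ _); exact: ccont_id.
have [|z za e e0|s sa smax] := @disc_max phi a rho; first exact: ltW.
  have : ccont F z.
    apply: ccontD; first by apply: ccontM; [|apply: conj_cont]; exact: cf.
    by apply: ccontM (ccont_cst _ _) _; apply: ccontM (cid z) _; exact: conj_cont.
  move=> /(_ e e0); apply: cnear_imp => w.
  by rewrite !phiE -rmorphB cabs_real.
have [sE|s_neq] := eqVneq (cabs (s - a)) rho.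
  have := smax z0 z0a; rewrite /phi sE => H.
  have : cabs (f s) ^+ 2 <= M ^+ 2 by rewrite ler_sqr ?nnegrE ?cabs_ge0 // bd.
  have : 0 <= eps * cabs (z0 - a) ^+ 2 by rewrite mulr_ge0 ?sqr_ge0 // ltW.
  lra.
have {s_neq} sa' : cabs (s - a) < rho by rewrite lt_neqAle s_neq.
have [r r0 dr] := df s sa'.
pose rr := Num.min r (rho - cabs (s - a)); pose t := rr / 2.
have rr0 : 0 < rr by rewrite lt_min r0 subr_gt0.
have [rr1 rr2] : rr <= r /\ rr <= rho - cabs (s - a).
  by rewrite /rr; split; rewrite ge_min lexx ?orbT.
(* Expanding the squares, [phi z - phi s] equals [2 Re (k z - k s) + |f z - f s|^2 + eps |z - s|^2].
   At a point of the circle where [Re k] agrees with its value at [s], this is positive. *)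
pose k z := conjc (f s) * f z + ((eps%:C)%C * conjc (s - a)) * z.
have [|||z zs] := @circle_mean_value R k s r t; last 1 first.
- rewrite /k; move=> Hre.
  have za : cabs (z - a) <= rho.
    by have := cabs_distD s z a; rewrite zs /t; lra.
  have := smax z za; rewrite /phi.
  have Ez : z - a = (s - a) + (z - s) by ring.
  have : complex.Re (conjc (f s) * (f z - f s)) + eps * complex.Re (conjc (s - a) * (z - s)) = 0.
    move: Hre => /eqP; rewrite -subr_eq0 -raddfB => /eqP <-.
    have -> : conjc (f s) * f z + (eps%:C)%C * conjc (s - a) * z
        - (conjc (f s) * f s + (eps%:C)%C * conjc (s - a) * s) =
      conjc (f s) * (f z - f s) + (eps%:C)%C * (conjc (s - a) * (z - s)) by ring.
    case: (f s) (f z) (s - a) (z - s) => [p q] [p' q'] [x y] [x1 y1] /=.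
    ring.
  have tt : 0 < eps * cabs (z - s) ^+ 2.
    by rewrite mulr_gt0 // zs exprn_gt0 // /t divr_gt0.
  move: tt; rewrite Ez !sqr_cabs.
  case: (f s) (f z) (s - a) (z - s) => [p q] [p' q'] [x y] [x1 y1] /=.
  have := sqr_ge0 (p' - p); have := sqr_ge0 (q' - q); lra.
- by apply: ccontD; apply: ccontM (ccont_cst _ _) _; [exact: cf | exact: ccont_id].
- move=> z Hz; apply: cdiffD; apply: cdiffM; try exact: cdiff_cst.
    exact: dr.
  exact: cdiff_id.
- by rewrite /t; lra.
Qed.

Definition cslope f b (d : R[i]) w := if w == b then d else (f w - f b) / (w - b).

Lemma cslopeE f b d w : f w - f b = cslope f b d w * (w - b).
Proof.
rewrite /cslope; case: eqVneq => [->|wb]; first by rewrite !subrr mulr0.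
by rewrite divfK // subr_eq0.
Qed.

Lemma cslope_off f b d w : w != b -> cnear w (fun v => (f v - f b) / (v - b) = cslope f b d v).
Proof.
move=> wb; exists (cabs (w - b)); first by rewrite cabs_gt0 subr_eq0.
move=> v vw; rewrite /cslope ifN //; apply: contraTneq vw => ->.
by rewrite cabs_distC ltxx.
Qed.

Lemma cslope_cdiff f b d w : w != b -> cdiff f w -> cdiff (cslope f b d) w.
Proof.
by move=> wb df; apply: cdiff_near (cslope_off f d wb) _; exact: cdiff_quotient.
Qed.

Lemma cslope_ccont f b d w : w != b -> ccont f w -> ccont (cslope f b d) w.
Proof.
move=> wb cf; apply: ccont_near (cslope_off f d wb) _; apply: ccontM.
  by apply: ccontB => //; exact: ccont_cst.
apply: ccontV; first by rewrite subr_eq0.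
by apply: ccontB (ccont_cst _ _); exact: ccont_id.
Qed.

Lemma cslope_ex f b : cdiff f b -> exists d, ccont (cslope f b d) b.
Proof.
move=> [q cq Hq]; exists (q b); apply: ccont_near cq; apply: cnear_imp Hq => w E.
rewrite /cslope; case: eqVneq => [->//|wb].
by rewrite E mulfK // subr_eq0.
Qed.

(** A zero [b] with [|b - a| < rho / 8] is divided out. On the circle [|z - b| >= 7/8 rho], while on
    the small disc [|z - b| <= rho / 4], so one division gains the factor [2/7 < 1/2]. The quotient
    satisfies the same hypotheses, which is why they tolerate exceptional points. *)
Lemma zeros_decay n f a rho (M : R) : 0 < rho ->
  (forall z, cabs (z - a) <= rho -> ccont f z) ->
  (forall s, cabs (s - a) < rho -> exists2 r : R, 0 < r &
     forall z, 0 < cabs (z - s) < r -> cdiff f z) ->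
  (forall z, cabs (z - a) = rho -> cabs (f z) <= M) ->
  (forall r : R, 0 < r -> exists2 z, 0 < cabs (z - a) < r & f z = 0) ->
  forall z, cabs (z - a) <= rho / 8 -> cabs (f z) <= M / 2 ^+ n.
Proof.
elim: n f M => [|n IH] f M rho0 cf df bd zf z za.
  rewrite expr0 divr1; apply: (@maximum_modulus f a rho M) => //.
  by apply: le_trans za _; rewrite ler_pdivrMr //; lra.
have [r r0 dr] : exists2 r : R, 0 < r & forall z, 0 < cabs (z - a) < r -> cdiff f z.
  by apply: df; rewrite subrr cabs0.
have r80 : 0 < rho / 8 by rewrite divr_gt0.
have [|b /andP[b0]] := zf (Num.min r (rho / 8)); first by rewrite lt_min r0.
rewrite lt_min => /andP[br b8] fb.
have [|d cd] := @cslope_ex f b; first by apply: dr; rewrite b0.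
pose g := cslope f b d.
have fE w : f w = g w * (w - b) by rewrite -cslopeE fb subr0.
have {}IH := IH g (M / (7 / 8 * rho)) rho0.
have gz : cabs (g z) <= M / (7 / 8 * rho) / 2 ^+ n.
  apply: IH => // {z za}.
  - move=> z za; have [->|zb] := eqVneq z b; first exact: cd.
    by apply: cslope_ccont => //; exact: cf.
  - move=> s sa; have [rs rs0 Hs] := df s sa.
    have [->|sb] := eqVneq s b.
      have [|rb rb0 Hb] := df b; first by lra.
      exists rb => // z zb; apply: cslope_cdiff; last exact: Hb.
      by rewrite -subr_eq0 -cabs_gt0; case/andP: zb.
    exists (Num.min rs (cabs (s - b))); first by rewrite lt_min rs0 cabs_gt0 subr_eq0.
    move=> z /andP[zs]; rewrite lt_min => /andP[zr zb].
    apply: cslope_cdiff; last by apply: Hs; rewrite zs.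
    by apply: contraTneq zb => ->; rewrite cabs_distC ltxx.
  - move=> z za; have zb : 7 / 8 * rho <= cabs (z - b).
      by have := cabs_distD b z a; rewrite za; lra.
    rewrite ler_pdivlMr; last by lra.
    apply: le_trans (bd z za); rewrite fE cabsM.
    by rewrite ler_wpM2l // cabs_ge0.
  (* Zeros of [f] closer to [a] than [b] differ from [b] and therefore remain zeros of the
     quotient. *)
  - move=> t t0; have [|z /andP[z0]] := zf (Num.min t (cabs (b - a))).
      by rewrite lt_min t0.
    rewrite lt_min => /andP[zt zb] fz; exists z; first by rewrite z0.
    apply/eqP; have /eqP := fE z; rewrite fz eq_sym mulf_eq0 => /orP[//|].
    by rewrite subr_eq0 => /eqP E; move: zb; rewrite E ltxx.
rewrite fE cabsM.
have zb : cabs (z - b) <= rho / 4.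
  by have := cabs_distD a z b; rewrite [cabs (a - b)]cabs_distC; lra.
have M0 : 0 <= M.
  have /bd : cabs ((a + (rho%:C)%C) - a) = rho.
    by rewrite addrAC subrr add0r cabs_real ger0_norm // ltW.
  by apply: le_trans; exact: cabs_ge0.
apply: (le_trans (ler_pM (cabs_ge0 _) (cabs_ge0 _) gz zb)).
have p0 : (2 ^+ n : R) != 0 by rewrite expf_neq0 // pnatr_eq0.
have -> : M / (7 / 8 * rho) / 2 ^+ n * (rho / 4) = M / 2 ^+ n * (2 / 7).
  by field; rewrite p0 gt_eqF.
have -> : M / 2 ^+ n.+1 = M / 2 ^+ n * (1 / 2) by rewrite exprS; field.
by rewrite ler_wpM2l ?divr_ge0 ?exprn_ge0 //; lra.
Qed.

Lemma isolated_zeros f a r : 0 < r -> (forall z, cabs (z - a) < r -> cdiff f z) ->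
  (exists2 r' : R, 0 < r' & forall z, cabs (z - a) < r' -> f z = 0) \/
  (exists2 r' : R, 0 < r' & forall z, 0 < cabs (z - a) < r' -> f z != 0).
Proof.
move=> r0 df; have [Z|NZ] := pselect (forall t : R, 0 < t -> exists2 z, 0 < cabs (z - a) < t & f z = 0).
  left; pose rho := r / 2; have rho0 : 0 < rho by rewrite divr_gt0.
  have rr : rho < r by rewrite /rho; lra.
  have [||c _ cmax] := @disc_max (fun z => cabs (f z)) a rho; first exact: ltW.
    move=> z za e /(cdiff_cont (df z (le_lt_trans za rr))); apply: cnear_imp => w.
    apply: le_trans; rewrite ler_norml; apply/andP.
    have := cabs_dist2 (f w) (f z); have := cabs_dist2 (f z) (f w).
    by rewrite [cabs (f z - _)]cabs_distC; split; lra.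
  exists (rho / 8); first by rewrite divr_gt0.
  move=> z /ltW za; apply/eqP; rewrite -cabs_eq0 eq_le cabs_ge0 andbT.
  have H n : cabs (f z) <= cabs (f c) / 2 ^+ n.
    apply: (@zeros_decay n f a rho) => //.
    - by move=> w wa; apply: cdiff_cont; apply: df; lra.
    - move=> s sa; exists (rho - cabs (s - a)); first by rewrite subr_gt0.
      by move=> w /andP[_ ws]; apply: df; have := cabs_distD s w a; lra.
    - by move=> w wa; apply: cmax; rewrite wa.
  apply/ler_addgt0Pr => e e0; rewrite add0r.
  have /= := @upper_nthrootP R (cabs (f c) / e) _ (leqnn _); move: (Num.bound _) => n Hn.
  apply: le_trans (H n) _; rewrite ler_pdivrMr ?exprn_gt0 // -ler_pdivrMl // mulrC.
  exact: ltW.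
right; move/existsNP: NZ => [t /not_implyP[t0 NZ]]; exists t => // z zt.
by apply/eqP => fz; apply: NZ; exists z.
Qed.

Lemma ccauchy_cvg (u : nat -> R[i]) :
  (forall e : R, 0 < e -> exists N, forall n m, (N <= n)%N -> (N <= m)%N -> cabs (u n - u m) <= e) ->
  exists l, forall e : R, 0 < e -> exists N, forall n, (N <= n)%N -> cabs (u n - l) <= e.
Proof.
have real (v : nat -> R) :
  (forall e : R, 0 < e -> exists N, forall n m, (N <= n)%N -> (N <= m)%N -> `|v n - v m| <= e) ->
  exists l, forall e : R, 0 < e -> exists N, forall n, (N <= n)%N -> `|v n - l| <= e.
  (* The supremum of the eventual lower bounds is the lower limit of [v]. *)
  move=> H; pose S := [set x | exists N, forall n, (N <= n)%N -> x <= v n].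
  exists (sup S) => e e0; have e2 : 0 < e / 2 by rewrite divr_gt0.
  have [N HN] := H _ e2; exists N => n Nn.
  have lo : S (v n - e / 2).
    by exists N => m Nm; have := HN n m Nn Nm; rewrite ler_norml; lra.
  have up : ubound S (v n + e / 2).
    move=> x [N' HN']; have := HN' (maxn N N') (leq_maxr _ _).
    by have := HN n (maxn N N') Nn (leq_maxl _ _); rewrite ler_norml; lra.
  have L1 : v n - e / 2 <= sup S by apply: ub_le_sup => //; exists (v n + e / 2).
  have L2 : sup S <= v n + e / 2 by apply: ge_sup => //; exists (v n - e / 2).
  by rewrite ler_norml; lra.
move=> H.
have [|x Hx] := real (fun n => complex.Re (u n)).
  move=> e /H[N HN]; exists N => n m Nn Nm; apply: le_trans (HN n m Nn Nm).
  by rewrite -raddfB; exact: Re_le_cabs.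
have [|y Hy] := real (fun n => complex.Im (u n)).
  move=> e /H[N HN]; exists N => n m Nn Nm; apply: le_trans (HN n m Nn Nm).
  by rewrite -raddfB; exact: Im_le_cabs.
exists (Complex x y) => e e0; have e2 : 0 < e / 2 by rewrite divr_gt0.
have [N HN] := Hx _ e2; have [N' HN'] := Hy _ e2.
exists (maxn N N') => n; rewrite geq_max => /andP[/HN H1 /HN' H2].
apply: le_trans (cabs_le_ReIm _) _; rewrite !raddfB /=; lra.
Qed.

(** Weierstrass's theorem without integrals. On the circle of radius [rho] the slopes at [a] are
    uniformly Cauchy, since division by [z - a] costs only [1 / rho]; the maximum principle extends
    this to the disc, including [a]. Their uniform limit is a continuous slope of [f]. *)
Lemma uniform_limit_cdiff (F : nat -> R[i] -> R[i]) f a r : 0 < r ->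
  (forall n z, cabs (z - a) < r -> cdiff (F n) z) ->
  (forall e : R, 0 < e -> exists N, forall n, (N <= n)%N ->
     forall z, cabs (z - a) < r -> cabs (F n z - f z) <= e) ->
  cdiff f a.
Proof.
move=> r0 dF cvgF.
pose rho := r / 2; have rho0 : 0 < rho by rewrite divr_gt0.
have rr : rho < r by rewrite /rho; lra.
have aa : cabs (a - a) < r by rewrite subrr cabs0.
have /choice[d Hd] : forall n, exists d, ccont (cslope (F n) a d) a.
  by move=> n; apply: cslope_ex; exact: dF.
pose G n := cslope (F n) a (d n).
have cG n z : cabs (z - a) <= rho -> ccont (G n) z.
  move=> za; have [->|zb] := eqVneq z a; first exact: Hd.
  by apply: cslope_ccont => //; apply: cdiff_cont; apply: dF; lra.
have cauchy (e : R) : 0 < e -> exists N, forall n m, (N <= n)%N -> (N <= m)%N ->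
   forall z, cabs (z - a) <= rho -> cabs (G n z - G m z) <= e.
  move=> e0; have [|N HN] := cvgF (e * rho / 4); first by rewrite divr_gt0 // mulr_gt0.
  exists N => n m Nn Nm; apply: maximum_modulus => //.
  - by move=> z za; apply: ccontB; exact: cG.
  - move=> s sa; have [->|sb] := eqVneq s a.
      exists r => // z /andP[za zr]; have za' : z != a by rewrite -subr_eq0 -cabs_gt0.
      by apply: cdiffB; apply: cslope_cdiff => //; exact: dF.
    exists (Num.min (r - cabs (s - a)) (cabs (s - a))).
      by rewrite lt_min cabs_gt0 !subr_gt0 subr_eq0 sb andbT; lra.
    move=> z /andP[_]; rewrite lt_min => /andP[zs zs'].
    have zr : cabs (z - a) < r by have := cabs_distD s z a; lra.
    have za' : z != a by apply: contraTneq zs' => ->; rewrite cabs_distC ltxx.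
    by apply: cdiffB; apply: cslope_cdiff => //; exact: dF.
  move=> z za; have zr : cabs (z - a) < r by rewrite za.
  have za' : z != a by rewrite -subr_eq0 -cabs_gt0 za.
  rewrite /G /cslope (negbTE za') -mulrBl cabsM cabsV za ler_pdivrMr //.
  have -> : F n z - F n a - (F m z - F m a) =
    (F n z - f z) - (F m z - f z) - ((F n a - f a) - (F m a - f a)) by ring.
  apply: le_trans (cabsB _ _) _.
  have := cabsB (F n z - f z) (F m z - f z); have := cabsB (F n a - f a) (F m a - f a).
  have := HN n Nn z zr; have := HN m Nm z zr; have := HN n Nn a aa; have := HN m Nm a aa.
  lra.
have [|l Hl] := @ccauchy_cvg d.
  move=> e /cauchy[N HN]; exists N => n m Nn Nm.
  have := HN n m Nn Nm a; rewrite subrr cabs0 /G /cslope eqxx; apply; exact: ltW.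
pose g := cslope f a l.
have Gg z : cabs (z - a) <= rho -> forall e : R, 0 < e -> exists N, forall n, (N <= n)%N ->
    cabs (G n z - g z) <= e.
  move=> za e e0; rewrite /G /g /cslope; case: eqVneq => [_|za']; first exact: Hl.
  have z0 : 0 < cabs (z - a) by rewrite cabs_gt0 subr_eq0.
  have [|N HN] := cvgF (e * cabs (z - a) / 2); first by rewrite divr_gt0 // mulr_gt0.
  exists N => n Nn; rewrite -mulrBl cabsM cabsV ler_pdivrMr //.
  have -> : F n z - F n a - (f z - f a) = (F n z - f z) - (F n a - f a) by ring.
  apply: le_trans (cabsB _ _) _.
  have := HN n Nn z (le_lt_trans za rr); have := HN n Nn a aa; lra.
exists g; last by exists 1 => // w _; exact: cslopeE.
move=> e e0; have e4 : 0 < e / 4 by rewrite divr_gt0.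
have e8 : 0 < e / 8 by rewrite divr_gt0.
have [N HN] := cauchy _ e8.
have unif z : cabs (z - a) <= rho -> cabs (G N z - g z) <= e / 4.
  move=> za; have [N' HN'] := Gg z za _ e8.
  have := cabs_distD (G (maxn N N') z) (G N z) (g z).
  have := HN N (maxn N N') (leqnn _) (leq_maxl _ _) z za.
  have := HN' _ (leq_maxr N N'); lra.
have := cG N a; rewrite subrr cabs0 => /(_ (ltW rho0) _ e4) H.
apply: cnear_imp (cnearI H (cnear_ball a rho0)) => w [wG /ltW wa].
have := cabs_distD (G N w) (g w) (g a); have := cabs_distD (G N a) (G N w) (g a).
have := unif w wa; have := unif a; rewrite subrr cabs0 => /(_ (ltW rho0)).
rewrite (cabs_distC (g w) (G N w)); lra.
Qed.

End DiscFacts.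

(** * Projective distance *)

Section Projective.
Variables (R : realType) (n : nat).
Implicit Types (a b g : 'rV[R[i]]_n) (e : R).

Lemma vnorm_ge0 a : 0 <= vnorm a.
Proof. exact: sqrtr_ge0. Qed.

Lemma sqr_vnorm a : vnorm a ^+ 2 = \sum_(i < n) cabs (a ord0 i) ^+ 2.
Proof. by rewrite sqr_sqrtr // sumr_ge0 // => i _; rewrite sqr_ge0. Qed.

Lemma cabs_le_vnorm a i : cabs (a ord0 i) <= vnorm a.
Proof.
rewrite -ler_sqr ?nnegrE ?cabs_ge0 ?vnorm_ge0 // sqr_vnorm (bigD1 i) //=.
by rewrite lerDl sumr_ge0 // => j _; rewrite sqr_ge0.
Qed.

Lemma vnorm_le a (t : R) : 0 <= t -> (forall i, cabs (a ord0 i) <= t) -> vnorm a <= n%:R * t.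
Proof.
move=> t0 H; rewrite -ler_sqr ?nnegrE ?vnorm_ge0 ?mulr_ge0 // sqr_vnorm.
apply: (@le_trans _ _ (\sum_(i < n) t ^+ 2)).
  by apply: ler_sum => i _; rewrite ler_sqr ?nnegrE ?cabs_ge0.
rewrite sumr_const card_ord -[leLHS]mulr_natl exprMn ler_wpM2r ?sqr_ge0 //.
by rewrite -natrX ler_nat; case: (n) => // k; rewrite leq_pmulr.
Qed.

Lemma vnorm_eq0 a : (vnorm a == 0) = (a == 0).
Proof.
apply/eqP/eqP => [a0|->].
  apply/rowP => i; rewrite mxE; apply/eqP; rewrite -cabs_eq0 eq_le cabs_ge0 andbT.
  by rewrite -a0 cabs_le_vnorm.
apply/eqP; rewrite eq_le vnorm_ge0 andbT.
have := @vnorm_le 0 0; rewrite mulr0; apply=> // i.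
by rewrite mxE cabs0.
Qed.

Lemma vnorm_gt0 a : (0 < vnorm a) = (a != 0).
Proof. by rewrite lt_def vnorm_ge0 andbT vnorm_eq0. Qed.

Lemma vnormZ c a : vnorm (c *: a) = cabs c * vnorm a.
Proof.
apply/eqP; rewrite -(@eqrXn2 _ 2) ?mulr_ge0 ?vnorm_ge0 ?cabs_ge0 //.
rewrite exprMn !sqr_vnorm mulr_sumr; apply/eqP; apply: eq_bigr => i _.
by rewrite mxE cabsM exprMn.
Qed.

Lemma vnorm_coord_ex a : a != 0 -> exists i, vnorm a <= n%:R * cabs (a ord0 i).
Proof.
rewrite -vnorm_gt0 => a0; apply: contrapT => /forallNP H.
have n0 : (0 < n)%N.
  rewrite lt0n; apply/eqP => n0.
  have : vnorm a <= n%:R * 0.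
    apply: vnorm_le => // i.
    by exfalso; have := leq_ltn_trans (leq0n i) (ltn_ord i); rewrite n0.
  by rewrite mulr0 leNgt a0.
have nR : 0 < n%:R :> R by rewrite ltr0n.
have lt i : cabs (a ord0 i) < vnorm a / n%:R.
  by rewrite ltr_pdivlMr // mulrC ltNge; apply/negP.
have : vnorm a ^+ 2 < \sum_(i < n) (vnorm a / n%:R) ^+ 2.
  rewrite sqr_vnorm; apply: ltr_sum; first by apply/hasP; exists (Ordinal n0); rewrite ?mem_index_enum.
  by move=> i _; rewrite ltr_pXn2r // nnegrE ?cabs_ge0 // divr_ge0 // ltW.
rewrite sumr_const card_ord -[ltRHS]mulr_natl exprMn exprVn mulrCA ltNge => /negP; apply.
rewrite ler_piMr ?sqr_ge0 // ler_pdivrMr ?exprn_gt0 // mul1r expr2 ler_peMr //.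
by rewrite ler1n.
Qed.

(** Each minor is at most the sine of the Fubini--Study angle times the two norms. The relation also
    holds trivially when one vector is zero, so a nonzero middle vector is demanded for
    transitivity. *)
Definition wclose a b e : Prop := forall i j,
  cabs (a ord0 i * b ord0 j - a ord0 j * b ord0 i) <= e * (vnorm a * vnorm b).

Lemma wclose_sym a b e : wclose a b e -> wclose b a e.
Proof.
move=> H i j; rewrite [vnorm b * _]mulrC; apply: le_trans (H i j).
by rewrite cabs_distC ![a _ _ * _]mulrC lexx.
Qed.

Lemma wclose_refl a e : 0 <= e -> wclose a a e.
Proof.
by move=> e0 i j; rewrite mulrC subrr cabs0 !mulr_ge0 ?vnorm_ge0.
Qed.

Lemma wcloseW a b e e' : e <= e' -> wclose a b e -> wclose a b e'.
Proof.
by move=> ee H i j; apply: le_trans (H i j) _; rewrite ler_wpM2r // mulr_ge0 ?vnorm_ge0.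
Qed.

(** Lagrange's identity. Over the complex numbers squared moduli become [z * conjc z], and the
    expanded double sum is symmetric under exchange of [i] and [j], whence the factor 2. *)
Lemma lagrange_identity a b :
  \sum_(i < n) \sum_(j < n) cabs (a ord0 i * b ord0 j - a ord0 j * b ord0 i) ^+ 2
    = 2 * (vnorm a ^+ 2 * vnorm b ^+ 2 - cabs (hdot a b) ^+ 2).
Proof.
apply: (@complexI R); rewrite rmorphM rmorphB rmorphM /= -!mulc_conj.
have vE (c : 'rV[R[i]]_n) : ((vnorm c ^+ 2)%:C)%C = \sum_(i < n) c ord0 i * conjc (c ord0 i).
  by rewrite sqr_vnorm rmorph_sum; apply: eq_bigr => i _; rewrite mulc_conj.
rewrite !vE rmorph_sum /=.
have -> : conjc (hdot a b) = \sum_(j < n) conjc (a ord0 j) * b ord0 j.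
  rewrite /hdot rmorph_sum; apply: eq_bigr => j _.
  by rewrite rmorphM /= conjcK.
rewrite /hdot !big_distrlr /= rmorphMn rmorph1 mulrBr.
pose T1 i j := a ord0 i * conjc (a ord0 i) * (b ord0 j * conjc (b ord0 j)).
pose T2 i j := a ord0 i * conjc (b ord0 i) * (conjc (a ord0 j) * b ord0 j).
transitivity (\sum_(i < n) \sum_(j < n) (T1 i j + T1 j i - (T2 i j + T2 j i))).
  apply: eq_bigr => i _; rewrite rmorph_sum; apply: eq_bigr => j _.
  by rewrite /= -mulc_conj rmorphB !rmorphM /T1 /T2 /=; ring.
have split2 (T : 'I_n -> 'I_n -> R[i]) :
   \sum_(i < n) \sum_(j < n) (T i j + T j i) = 2 * \sum_(i < n) \sum_(j < n) T i j.
  under eq_bigr do rewrite big_split /=.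
  by rewrite big_split /= [X in _ + X]exchange_big mulr2n mulrDl !mul1r.
transitivity (2 * (\sum_(i < n) \sum_(j < n) T1 i j) - 2 * (\sum_(i < n) \sum_(j < n) T2 i j));
  last by [].
by rewrite -!split2 -sumrB; apply: eq_bigr => i _; rewrite -sumrB.
Qed.

Lemma hdot_le a b : cabs (hdot a b) <= vnorm a * vnorm b.
Proof.
rewrite -ler_sqr ?nnegrE ?mulr_ge0 ?cabs_ge0 ?vnorm_ge0 // exprMn -subr_ge0.
rewrite -(pmulr_rge0 _ (@ltr0n R 2)) -lagrange_identity.
by apply: sumr_ge0 => i _; apply: sumr_ge0 => j _; rewrite sqr_ge0.
Qed.

Definition pcos a b : R := cabs (hdot a b) / (vnorm a * vnorm b).

Lemma pcos_bounds a b : 0 <= pcos a b <= 1.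
Proof.
rewrite divr_ge0 ?cabs_ge0 ?mulr_ge0 ?vnorm_ge0 //=.
rewrite /pcos; have [->|d0] := eqVneq (vnorm a * vnorm b) 0; first by rewrite invr0 mulr0.
rewrite ler_pdivrMr ?mul1r ?hdot_le //.
by rewrite lt_def d0 mulr_ge0 ?vnorm_ge0.
Qed.

Lemma wedge_sum_pcos a b : a != 0 -> b != 0 ->
  \sum_(i < n) \sum_(j < n) cabs (a ord0 i * b ord0 j - a ord0 j * b ord0 i) ^+ 2
    = 2 * ((1 - pcos a b ^+ 2) * (vnorm a * vnorm b) ^+ 2).
Proof.
move=> a0 b0; rewrite lagrange_identity /pcos; field.
by rewrite !vnorm_eq0 a0 b0.
Qed.

(** A small angle has cosine close to 1 by continuity, and [wedge_sum_pcos] bounds the minors by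
    [1 - pcos a b ^+ 2]. *)
Lemma fs_dist_wclose e : 0 < e -> exists2 d : R, 0 < d &
  forall a b, fs_dist a b <= d -> wclose a b e.
Proof.
move=> e0.
have [d d0 Hd] : exists2 d : R, 0 < d & forall y, `|y| < d -> `|cos y - 1| <= e ^+ 2 / 4.
  have : {for (0 : R), continuous (@cos R)} by exact: continuous_cos.
  move=> /cvgrPdist_le /(_ (e ^+ 2 / 4)); rewrite divr_gt0 ?exprn_gt0 // => /(_ isT).
  move=> /nbhs_ballP[d /= d0 H]; exists d => // y yd.
  have := H y; rewrite /= cos0 distrC; apply.
  by rewrite /ball /= sub0r normrN.
exists (d / 2); first by rewrite divr_gt0.
move=> a b H.
have [->|a0] := eqVneq a 0.
  by move=> i j; rewrite !mxE !mul0r subrr cabs0 !mulr_ge0 ?vnorm_ge0 // ltW.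
have [->|b0] := eqVneq b 0.
  by move=> i j; rewrite !mxE !mulr0 subrr cabs0 !mulr_ge0 ?vnorm_ge0 // ltW.
have /andP[c0 c1] := pcos_bounds a b.
have c11 : -1 <= pcos a b <= 1 by rewrite c1 andbT; lra.
have [/andP[A0 _] cA] := acos_def c11.
have cosE : pcos a b >= 1 - e ^+ 2 / 4.
  rewrite -cA; have := Hd (acos (pcos a b)); rewrite ger0_norm // => /(_ (le_lt_trans H _)).
  by rewrite ler_norml => /(_ ltac:(lra)); lra.
have E2 : 0 <= e ^+ 2 by rewrite sqr_ge0.
have sq : 1 - pcos a b ^+ 2 <= e ^+ 2 / 2.
  have : (1 - pcos a b) * (1 + pcos a b) <= (1 - pcos a b) * 2 by rewrite ler_wpM2l; lra.
  lra.
move=> i j; rewrite -ler_sqr ?nnegrE ?cabs_ge0 ?mulr_ge0 ?vnorm_ge0 ?(ltW e0) //.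
apply: (@le_trans _ _ (2 * ((1 - pcos a b ^+ 2) * (vnorm a * vnorm b) ^+ 2))).
  rewrite -wedge_sum_pcos // (bigD1 i) //= (bigD1 j) //= -addrA lerDl addr_ge0 //.
    by apply: sumr_ge0 => l _; rewrite sqr_ge0.
  by apply: sumr_ge0 => l _; apply: sumr_ge0 => l' _; rewrite sqr_ge0.
rewrite [leRHS]exprMn mulrA ler_wpM2r ?sqr_ge0 //; lra.
Qed.

Lemma wclose_fs_dist e : 0 < e -> exists2 d : R, 0 < d &
  forall a b, a != 0 -> b != 0 -> wclose a b d -> fs_dist a b <= e.
Proof.
(* Capping at 1 keeps [t] below [pi / 2], where the cosine is nonnegative and decreasing. *)
move=> e0; pose t := Num.min e 1.
have t0 : 0 < t by rewrite lt_min e0 ltr01.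
have [te t1] : t <= e /\ t <= 1 by rewrite /t; split; rewrite ge_min lexx ?orbT.
have tpi : t <= pi by have := @pi_ge2 R; lra.
have ct : cos t < 1.
  by rewrite -cos0 ltr_cos // in_itv /= ?lexx ?pi_ge0 ?tpi ?(ltW t0).
have ct0 : 0 <= cos t by apply: cos_ge0_pihalf; have := @pi_ge2 R; lra.
pose s := 1 - cos t ^+ 2; have s0 : 0 < s.
  rewrite /s (_ : _ - _ = (1 - cos t) * (1 + cos t)); last by ring.
  by rewrite mulr_gt0 //; lra.
pose N := n%:R ^+ 2 + 1 : R; have N0 : 0 < N by rewrite /N; have := sqr_ge0 (n%:R : R); lra.
exists (Num.min 1 (2 * s / N)); first by rewrite lt_min ltr01 divr_gt0 // mulr_gt0.
set d := Num.min _ _ => a b a0 b0 H.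
have d0 : 0 < d by rewrite lt_min ltr01 divr_gt0 // mulr_gt0.
have [d1 ds] : d <= 1 /\ d * N <= 2 * s.
  by rewrite /d -ler_pdivlMr //; split; rewrite ge_min lexx ?orbT.
have /andP[c0 c1] := pcos_bounds a b.
have c11 : -1 <= pcos a b <= 1 by rewrite c1 andbT; lra.
have [/andP[A0 A1] cA] := acos_def c11.
have nn : 0 < (vnorm a * vnorm b) ^+ 2 by rewrite exprn_gt0 // mulr_gt0 ?vnorm_gt0.
have main : 2 * ((1 - pcos a b ^+ 2) * (vnorm a * vnorm b) ^+ 2) <=
   n%:R ^+ 2 * d ^+ 2 * (vnorm a * vnorm b) ^+ 2.
  rewrite -wedge_sum_pcos //.
  apply: (@le_trans _ _ (\sum_(i < n) \sum_(j < n) (d * (vnorm a * vnorm b)) ^+ 2)).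
    apply: ler_sum => i _; apply: ler_sum => j _.
    by rewrite ler_sqr ?nnegrE ?cabs_ge0 ?mulr_ge0 ?vnorm_ge0 ?(ltW d0).
  rewrite !sumr_const !card_ord -mulrnA -[leLHS]mulr_natl natrM.
  by rewrite [X in _ * X <= _]exprMn mulrA -expr2.
rewrite mulrA ler_pM2r // in main.
have Nn : n%:R ^+ 2 * d ^+ 2 <= N * d.
  have : n%:R ^+ 2 * d ^+ 2 <= n%:R ^+ 2 * d.
    by rewrite ler_wpM2l ?sqr_ge0 // expr2 ler_piMl // ltW.
  by rewrite /N; lra.
have cc : cos t <= pcos a b.
  rewrite -ler_sqr ?nnegrE //; move: ds main Nn; rewrite /s; lra.
apply: le_trans te; rewrite /fs_dist -/(pcos a b) leNgt; apply/negP => lt.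
have : cos (acos (pcos a b)) < cos t.
  by rewrite ltr_cos // in_itv /= ?A0 ?A1 ?(ltW t0) ?tpi.
by rewrite cA ltNge cc.
Qed.

(** With [j] a dominant coordinate of [a], the minor for [j] and [l] compares [a_j g_l] with
    [a_l g_j]: a coordinate that is not small in [g] cannot be small in a nearby [a]. *)
Lemma wclose_lower a g e (c : R) l : a != 0 -> g != 0 -> wclose a g e ->
  c * vnorm g <= cabs (g ord0 l) -> 0 <= c ->
  (c - n%:R * e) * vnorm a <= n%:R * cabs (a ord0 l).
Proof.
move=> a0 g0 H Hc c0; have [j aj] := vnorm_coord_ex a0.
move: g0; rewrite -vnorm_gt0 => g0.
have n0 : 0 <= n%:R :> R by [].
have Hj := H j l.
have T := cabs_dist2 (a ord0 j * g ord0 l) (a ord0 l * g ord0 j).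
rewrite !cabsM in T.
have U : cabs (a ord0 l) * cabs (g ord0 j) <= cabs (a ord0 l) * vnorm g.
  by rewrite ler_wpM2l ?cabs_ge0 ?cabs_le_vnorm.
have V : cabs (a ord0 j) * (c * vnorm g) <= cabs (a ord0 j) * cabs (g ord0 l).
  by rewrite ler_wpM2l ?cabs_ge0.
have W : c * cabs (a ord0 j) <= cabs (a ord0 l) + e * vnorm a.
  by rewrite -(ler_pM2r g0); lra.
have X : n%:R * (c * cabs (a ord0 j)) <= n%:R * (cabs (a ord0 l) + e * vnorm a).
  by rewrite ler_wpM2l.
have Y : c * vnorm a <= c * (n%:R * cabs (a ord0 j)) by rewrite ler_wpM2l.
lra.
Qed.

(** For a dominant coordinate [G] of [g], [G ^+ 2] times a minor of [a] and [b] is a sum of four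
    terms, each containing a minor with [g]. This gives the constant 4; 6 leaves slack. *)
Lemma wclose_trans a b g e : g != 0 -> 0 <= e <= 1 -> wclose a g e -> wclose b g e ->
  wclose a b (6 * n%:R ^+ 2 * e).
Proof.
move=> g0 /andP[e0 e1] Ha Hb i j.
have [l gl] := vnorm_coord_ex g0; move: g0; rewrite -vnorm_gt0 => g0.
have [na nb] := (vnorm_ge0 a, vnorm_ge0 b).
pose G := g ord0 l.
pose x i := a ord0 i * G - a ord0 l * g ord0 i.
pose y i := b ord0 i * G - b ord0 l * g ord0 i.
have xb i' : cabs (x i') <= e * (vnorm a * vnorm g) by exact: Ha.
have yb i' : cabs (y i') <= e * (vnorm b * vnorm g) by exact: Hb.
have E : G ^+ 2 * (a ord0 i * b ord0 j - a ord0 j * b ord0 i) =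
   a ord0 l * g ord0 i * y j + x i * (b ord0 j * G)
   - (a ord0 l * g ord0 j * y i + x j * (b ord0 i * G)).
  by rewrite /x /y; ring.
have K1 p q : cabs (a ord0 l * g ord0 p * y q) <= e * (vnorm a * vnorm b * vnorm g ^+ 2).
  rewrite !cabsM; apply: (@le_trans _ _ (vnorm a * vnorm g * (e * (vnorm b * vnorm g)))).
    by rewrite !ler_pM ?mulr_ge0 ?cabs_ge0 ?cabs_le_vnorm.
  by rewrite le_eqVlt; apply/orP; left; apply/eqP; ring.
have K2 p q : cabs (x p * (b ord0 q * G)) <= e * (vnorm a * vnorm b * vnorm g ^+ 2).
  rewrite !cabsM; apply: (@le_trans _ _ (e * (vnorm a * vnorm g) * (vnorm b * vnorm g))).
    by rewrite !ler_pM ?mulr_ge0 ?cabs_ge0 ?cabs_le_vnorm.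
  by rewrite le_eqVlt; apply/orP; left; apply/eqP; ring.
set w := _ - _ in E *.
have B : cabs G ^+ 2 * cabs w <= 4 * e * (vnorm a * vnorm b * vnorm g ^+ 2).
  rewrite -cabsX -cabsM E; apply: le_trans (cabsB _ _) _.
  have := cabsD (a ord0 l * g ord0 i * y j) (x i * (b ord0 j * G)).
  have := cabsD (a ord0 l * g ord0 j * y i) (x j * (b ord0 i * G)).
  by have := K1 i j; have := K2 i j; have := K1 j i; have := K2 j i; lra.
have gG : vnorm g ^+ 2 <= n%:R ^+ 2 * cabs G ^+ 2.
  by rewrite -exprMn ler_sqr ?nnegrE ?mulr_ge0 ?cabs_ge0 ?vnorm_ge0.
have g2 : 0 < vnorm g ^+ 2 by rewrite exprn_gt0.
rewrite -(ler_pM2l g2).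
have T1 : vnorm g ^+ 2 * cabs w <= n%:R ^+ 2 * cabs G ^+ 2 * cabs w.
  by rewrite ler_wpM2r ?cabs_ge0.
have T2 : n%:R ^+ 2 * (cabs G ^+ 2 * cabs w) <= n%:R ^+ 2 * (4 * e * (vnorm a * vnorm b * vnorm g ^+ 2)).
  by rewrite ler_wpM2l ?sqr_ge0.
have T3 : 0 <= n%:R ^+ 2 * (e * (vnorm a * vnorm b * vnorm g ^+ 2)).
  by rewrite !mulr_ge0 ?sqr_ge0 ?vnorm_ge0.
lra.
Qed.

Lemma wclose_near a e : a != 0 -> 0 < e -> exists2 d : R, 0 < d &
  forall b, (forall i, cabs (b ord0 i - a ord0 i) <= d) -> wclose b a e.
Proof.
move=> a0 e0; have [l al] := vnorm_coord_ex a0; move: a0; rewrite -vnorm_gt0 => a0.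
pose d := Num.min (cabs (a ord0 l) / 2) (e * cabs (a ord0 l) / 4).
have A0 : 0 < cabs (a ord0 l).
  rewrite lt_def cabs_ge0 andbT; apply: contraTneq al => ->.
  by rewrite mulr0 leNgt a0.
have d0 : 0 < d by rewrite lt_min !divr_gt0 // mulr_gt0.
have [d1 d2] : d <= cabs (a ord0 l) / 2 /\ d <= e * cabs (a ord0 l) / 4.
  by rewrite /d; split; rewrite ge_min lexx ?orbT.
exists d => // b H i j.
have nb : cabs (a ord0 l) / 2 <= vnorm b.
  have := cabs_dist2 (a ord0 l) (b ord0 l); have := H l; rewrite cabs_distC.
  have := cabs_le_vnorm b l; lra.
have -> : b ord0 i * a ord0 j - b ord0 j * a ord0 i =
  (b ord0 i - a ord0 i) * a ord0 j - (b ord0 j - a ord0 j) * a ord0 i by ring.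
apply: le_trans (cabsB _ _) _; rewrite !cabsM.
have T i' j' : cabs (b ord0 i' - a ord0 i') * cabs (a ord0 j') <= d * vnorm a.
  by rewrite ler_pM ?cabs_ge0 ?cabs_le_vnorm.
apply: le_trans (lerD (T i j) (T j i)) _.
rewrite mulrA -mulrDl ler_wpM2r ?vnorm_ge0 //.
have : e * (cabs (a ord0 l) / 2) <= e * vnorm b by rewrite ler_wpM2l // ltW.
lra.
Qed.

End Projective.

(** * Completeness of projective space *)

Lemma le_of_le_addgt0 (R : realType) (x y : R) : (forall s : R, 0 < s -> x <= y + s) -> x <= y.
Proof. by move=> H; apply/ler_addgt0Pr => s; exact: H. Qed.

Section Completeness.
Variables (R : realType) (n : nat).

(** A coordinate [l] dominant in one late term stays comparable to the norm in all later terms, so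
    the sequence lives in the affine chart of [l], where the ratios converge. The estimate for the
    limit holds from the same index [N] as the Cauchy bound: uniform Cauchy bounds thereby turn
    limits chosen pointwise into uniform ones. *)
Lemma wcauchy_limit (x : nat -> 'rV[R[i]]_n) : (forall p, x p != 0) ->
  (forall e : R, 0 < e -> exists N, forall p q, (N <= p)%N -> (N <= q)%N -> wclose (x p) (x q) e) ->
  exists2 y, y != 0 & forall (e : R) N, 0 <= e ->
    (forall p q, (N <= p)%N -> (N <= q)%N -> wclose (x p) (x q) e) ->
    forall p, (N <= p)%N -> wclose (x p) y (2 * n%:R ^+ 2 * e).
Proof.
move=> x0 H.
have n0 : 0 < n%:R :> R.
  have [i _] := vnorm_coord_ex (x0 0%N).
  by rewrite ltr0n; apply: leq_ltn_trans (ltn_ord i).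
pose K : R := 2 * n%:R ^+ 2.
have K0 : 0 < K by rewrite mulr_gt0 // exprn_gt0.
(* With closeness [K^-1], [wclose_lower] loses exactly half of the lower bound [n%:R^-1]. *)
have [N0 HN0] := H K^-1 (ltac:(by rewrite invr_gt0)).
have [l Hl] := vnorm_coord_ex (x0 N0).
have low p : (N0 <= p)%N -> vnorm (x p) <= K * cabs (x p ord0 l).
  move=> Np; have := @wclose_lower _ _ (x p) (x N0) K^-1 n%:R^-1 l (x0 p) (x0 N0)
    (HN0 p N0 Np (leqnn _)).
  rewrite ler_pdivrMl // invr_ge0 => /(_ Hl (ltW n0)).
  have -> : n%:R^-1 - n%:R / K = (2 * n%:R)^-1 by rewrite /K; field; rewrite gt_eqF.
  by rewrite ler_pdivrMl ?mulr_gt0 // /K => L; apply: le_trans L _; rewrite le_eqVlt; apply/orP; left; apply/eqP; ring.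
have xl p : (N0 <= p)%N -> 0 < cabs (x p ord0 l).
  move=> /low; have := x0 p; rewrite -vnorm_gt0 => h1 h2.
  by have := lt_le_trans h1 h2; rewrite pmulr_rgt0.
have dist p q i e : 0 <= e -> (N0 <= p)%N -> (N0 <= q)%N -> wclose (x p) (x q) e ->
   cabs (x p ord0 i / x p ord0 l - x q ord0 i / x q ord0 l) <= e * K ^+ 2.
  move=> e0 Np Nq W.
  have [xp xq] := (xl p Np, xl q Nq).
  have -> : x p ord0 i / x p ord0 l - x q ord0 i / x q ord0 l =
     (x p ord0 i * x q ord0 l - x p ord0 l * x q ord0 i) / (x p ord0 l * x q ord0 l).
    by field; rewrite -!cabs_gt0 xp xq.
  rewrite cabsM cabsV cabsM ler_pdivrMr ?mulr_gt0 //.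
  apply: le_trans (W i l) _; rewrite -mulrA ler_wpM2l // expr2 mulrACA.
  by rewrite ler_pM ?vnorm_ge0 // low.
have cau i : exists L, forall e : R, 0 < e -> exists N, forall p, (N <= p)%N ->
    cabs (x (p + N0)%N ord0 i / x (p + N0)%N ord0 l - L) <= e.
  apply: ccauchy_cvg => e e0; have eK : 0 < e / K ^+ 2 by rewrite divr_gt0 // exprn_gt0.
  have [N HN] := H _ eK; exists N => p q Np Nq.
  have -> : e = e / K ^+ 2 * K ^+ 2 by rewrite divfK // expf_neq0 // gt_eqF.
  apply: dist; rewrite ?leq_addl ?(ltW eK) //.
  by apply: HN; [apply: leq_trans Np _|apply: leq_trans Nq _]; exact: leq_addr.
have [L HL] := choice cau.
pose y : 'rV[R[i]]_n := \row_i L i.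
have Ll : L l = 1.
  apply/eqP; rewrite eq_sym -subr_eq0 -cabs_eq0 eq_le cabs_ge0 andbT.
  apply/ler_addgt0Pr => e /(HL l)[N /(_ _ (leqnn N))]; rewrite add0r divff //.
  by rewrite -cabs_gt0 xl // leq_addl.
have y1 : 1 <= vnorm y by have := cabs_le_vnorm y l; rewrite mxE Ll cabs1.
exists y; first by rewrite -vnorm_gt0; lra.
move=> e N e0 HN p Np i j; rewrite !mxE -/K.
have nx := vnorm_ge0 (x p).
apply: (@le_trans _ _ (K * e * vnorm (x p))); last first.
  rewrite ler_wpM2l ?mulr_ge0 // ?(ltW K0) //.
  by rewrite ler_peMr.
apply: le_of_le_addgt0 => s s0.
pose s' : R := s / (2 * (vnorm (x p) + 1)).
have s'0 : 0 < s' by rewrite divr_gt0 // mulr_gt0 //; lra.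
have s'E : 2 * s' * vnorm (x p) <= s.
  have -> : s = 2 * s' * (vnorm (x p) + 1) by rewrite /s'; field; rewrite gt_eqF //; lra.
  by apply: ler_wpM2l; [rewrite mulr_ge0 // ltW | rewrite lerDl].
have [M1 HM1] := HL i _ s'0; have [M2 HM2] := HL j _ s'0.
pose q := maxn N (maxn M1 M2).
have := HM1 q; rewrite /q !leq_max leqnn !orbT => /(_ isT).
have := HM2 q; rewrite /q !leq_max leqnn !orbT => /(_ isT); rewrite -/q.
set Q := (q + N0)%N => D2 D1.
have NQ0 : (N0 <= Q)%N by exact: leq_addl.
have NQ : (N <= Q)%N by rewrite (leq_trans (leq_maxl N (maxn M1 M2))) // leq_addr.
have xq := xl Q NQ0.
have W := HN p Q Np NQ i j.
have E : x p ord0 i * L j - x p ord0 j * L i =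
   (x p ord0 i * x Q ord0 j - x p ord0 j * x Q ord0 i) / x Q ord0 l
   - x p ord0 i * (x Q ord0 j / x Q ord0 l - L j) + x p ord0 j * (x Q ord0 i / x Q ord0 l - L i).
  by field; rewrite -cabs_gt0.
rewrite E; apply: le_trans (cabsD _ _) _.
have T1 := cabsB ((x p ord0 i * x Q ord0 j - x p ord0 j * x Q ord0 i) / x Q ord0 l)
   (x p ord0 i * (x Q ord0 j / x Q ord0 l - L j)).
have T2 : cabs ((x p ord0 i * x Q ord0 j - x p ord0 j * x Q ord0 i) / x Q ord0 l) <= K * e * vnorm (x p).
  rewrite cabsM cabsV ler_pdivrMr //; apply: le_trans W _.
  have : e * vnorm (x p) * vnorm (x Q) <= e * vnorm (x p) * (K * cabs (x Q ord0 l)).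
    by rewrite ler_wpM2l ?mulr_ge0 // low.
  lra.
have T3 : cabs (x p ord0 i * (x Q ord0 j / x Q ord0 l - L j)) <= vnorm (x p) * s'.
  by rewrite cabsM ler_pM ?cabs_ge0 ?cabs_le_vnorm.
have T4 : cabs (x p ord0 j * (x Q ord0 i / x Q ord0 l - L i)) <= vnorm (x p) * s'.
  by rewrite cabsM ler_pM ?cabs_ge0 ?cabs_le_vnorm.
lra.
Qed.

End Completeness.

(** * Tube domains and restriction to complex lines *)

Section Tube.
Variables (R : realType) (m : nat).
Implicit Types (O : set 'rV[R]_m) (z w v : 'rV[R[i]]_m).

Definition snear z (r : R) w : Prop := forall i, cabs (w ord0 i - z ord0 i) < r.

Lemma snearW z w (r r' : R) : r <= r' -> snear z r w -> snear z r' w.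
Proof. by move=> rr H i; exact: lt_le_trans (H i) rr. Qed.

Lemma snear_refl z (r : R) : 0 < r -> snear z r z.
Proof. by move=> r0 i; rewrite subrr cabs0. Qed.

Lemma snear_trans z w v (r s t : R) : r + s <= t -> snear z r w -> snear w s v -> snear z t v.
Proof.
move=> rst H1 H2 i; have := H1 i; have := H2 i.
by have := cabs_distD (w ord0 i) (v ord0 i) (z ord0 i); lra.
Qed.

Lemma relcpt_tube O' O z : relcpt O' O -> tube O' z -> tube O z.
Proof. by move=> [K [_ [KO O'K]]] /O'K /KO. Qed.

Lemma relcpt_box O (y : 'rV[R]_m) : open O -> O y ->
  exists2 r : R, 0 < r & relcpt [set y' | forall i, `|y' ord0 i - y ord0 i| <= r] O.
Proof.
move=> oO Oy; have /nbhs_ballP[e /= e0 He] := open_nbhs_nbhs (conj oO Oy).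
exists (e / 2); first by rewrite divr_gt0.
pose K := [set y' : 'rV[R]_m | forall i, `[y ord0 i - e / 2, y ord0 i + e / 2]%classic (y' ord0 i)].
exists K; split; first by
  apply: (@rV_compact R m (fun i => `[y ord0 i - e / 2, y ord0 i + e / 2]%classic)) => i;
  exact: segment_compact.
have KE y' : K y' <-> forall i, `|y' ord0 i - y ord0 i| <= e / 2.
  split=> H i; have := H i; rewrite /= in_itv /= ler_norml; lra.
split=> y' /KE H //; apply: He; split=> // i j; rewrite ord1 /ball /= distrC.
by apply: le_lt_trans (H j) _; lra.
Qed.

(** Convergence is uniform only on tubes over relatively compact sets, so local arguments start in a
    polydisc contained in one of these. *)
Lemma tube_box O z : open O -> tube O z -> exists2 r : R, 0 < r &
  exists2 O', relcpt O' O & forall w, snear z r w -> tube O' w.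
Proof.
move=> oO Oz; have [r r0 Hr] := relcpt_box oO Oz.
exists r => //; eexists; first exact: Hr.
move=> w H i; rewrite !mxE -raddfB; apply: le_trans (Im_le_cabs _) _.
by rewrite ltW // H.
Qed.

Lemma snear_line z v (c : R[i]) (r : R) : 0 < r -> exists2 s : R, 0 < s &
  forall d, cabs (d - c) < s -> snear (z + c *: v) r (z + d *: v).
Proof.
move=> r0; have v1 : 0 < vnorm v + 1 by have := vnorm_ge0 v; lra.
exists (r / (vnorm v + 1)); first by rewrite divr_gt0.
move=> d; rewrite ltr_pdivlMr // => H i.
rewrite !mxE opprD addrACA subrr add0r -mulrBl cabsM.
apply: le_lt_trans H; rewrite ler_wpM2l ?cabs_ge0 //.
by have := cabs_le_vnorm v i; lra.
Qed.

Lemma tube_realv O z (t : 'rV[R]_m) : tube O (z + realv t) = tube O z.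
Proof.
rewrite /tube /=; congr (O _); apply/rowP => i.
by rewrite !mxE raddfD /= addr0.
Qed.

Lemma holo_shift O (f : 'rV[R[i]]_m -> R[i]) (t : 'rV[R]_m) :
  holo (tube O) f -> holo (tube O) (fun z => f (z + realv t)).
Proof.
move=> hf z Oz; have [|a Ha] := hf (z + realv t); first by rewrite tube_realv.
exists a => e e0; have [d d0 Hd] := Ha e e0; exists d => // w wd Ow.
by have := Hd w wd; rewrite ![z + realv t + w]addrAC tube_realv; apply.
Qed.

Lemma holo_cont (D : set 'rV[R[i]]_m) (f : 'rV[R[i]]_m -> R[i]) z (e : R) : holo D f -> D z -> 0 < e ->
  exists2 r : R, 0 < r & forall w, snear z r w -> D w -> cabs (f w - f z) <= e.
Proof.
move=> hf Dz e0; have [a /(_ 1 ltr01)[d d0 Hd]] := hf z Dz.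
pose S : R := \sum_(i < m) cabs (a ord0 i).
have S0 : 0 <= S by apply: sumr_ge0 => i _; exact: cabs_ge0.
have m0 : 0 <= m%:R :> R by [].
pose M := S + m%:R + 1; have M0 : 0 < M by rewrite /M; lra.
pose r := Num.min (d / M) (e / M).
have r0 : 0 < r by rewrite lt_min !divr_gt0.
have [r1 r2] : r * M <= d /\ r * M <= e.
  by rewrite -!ler_pdivlMr //; split; rewrite ge_min lexx ?orbT.
exists r => // w H Dw; pose u := w - z.
have Ew : z + u = w by rewrite /u addrC subrK.
have ui i : cabs (u ord0 i) <= r by rewrite !mxE ltW // H.
have un : vnorm u <= m%:R * r by apply: vnorm_le => //; exact: ltW.
have Sr : 0 <= S * r by rewrite mulr_ge0 // ltW.
have := Hd u; rewrite Ew => /(_ _ Dw); rewrite mul1r => Hu.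
have {}Hu := Hu (ltac:(rewrite /M in r1; lra)).
have au : cabs (\sum_(i < m) a ord0 i * u ord0 i) <= S * r.
  rewrite /S mulr_suml.
  elim/big_ind2: _ => [|x1 x2 y1 y2 h1 h2|i _]; first by rewrite cabs0.
    by apply: le_trans (cabsD _ _) _; exact: lerD.
  by rewrite cabsM ler_wpM2l ?cabs_ge0.
have := cabsD (f w - f z - \sum_(i < m) a ord0 i * u ord0 i) (\sum_(i < m) a ord0 i * u ord0 i).
rewrite subrK; move: r2; rewrite /M; lra.
Qed.

Lemma holo_line (D : set 'rV[R[i]]_m) (f : 'rV[R[i]]_m -> R[i]) z v (c : R[i]) (r : R) :
  holo D f -> 0 < r -> (forall d, cabs (d - c) < r -> D (z + d *: v)) ->
  cdiff (fun d => f (z + d *: v)) c.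
Proof.
move=> hf r0 HD.
have Dc : D (z + c *: v) by apply: HD; rewrite subrr cabs0.
have [a Ha] := hf _ Dc.
pose g d := f (z + d *: v); pose b : R[i] := \sum_(i < m) a ord0 i * v ord0 i.
exists (cslope g c b); last by exists 1 => // d _; exact: cslopeE.
have v1 : 0 < vnorm v + 1 by have := vnorm_ge0 v; lra.
move=> e e0; have [s s0 Hs] := Ha (e / (vnorm v + 1)) (divr_gt0 e0 v1).
exists (Num.min r (s / (vnorm v + 1))); first by rewrite lt_min r0 divr_gt0.
move=> d; rewrite lt_min => /andP[dr]; rewrite ltr_pdivlMr // => ds.
have -> : cslope g c b c = b by rewrite /cslope eqxx.
rewrite {1}/cslope; case: eqVneq => [_|dc]; first by rewrite subrr cabs0 ltW.
have dc0 : 0 < cabs (d - c) by rewrite cabs_gt0 subr_eq0.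
have Ed : z + c *: v + (d - c) *: v = z + d *: v.
  by rewrite -addrA -scalerDl [c + _]addrC subrK.
have := Hs ((d - c) *: v); rewrite Ed vnormZ => /(_ _ (HD d dr)).
have dv : cabs (d - c) * vnorm v <= cabs (d - c) * (vnorm v + 1).
  by rewrite ler_wpM2l ?cabs_ge0 // lerDl.
move=> /(_ (le_lt_trans dv ds)).
have -> : \sum_(i < m) a ord0 i * ((d - c) *: v) ord0 i = b * (d - c).
  by rewrite /b mulr_suml; apply: eq_bigr => i _; rewrite mxE mulrCA mulrC.
move=> H; have -> : (g d - g c) / (d - c) - b = (g d - g c - b * (d - c)) / (d - c).
  by field; rewrite subr_eq0.
rewrite cabsM cabsV ler_pdivrMr //; apply: le_trans H _.
rewrite -mulrA ler_wpM2l ?(ltW e0) // ler_pdivrMl //.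
by rewrite [leRHS]mulrC.
Qed.

(** The identity theorem is phrased for sets instead of functions: zero sets of coordinates of a
    limit map make sense even though those coordinates need not be holomorphic, and finite unions
    keep the property. *)
Definition line_dichotomy O (Z : set 'rV[R[i]]_m) : Prop := forall z v, tube O z ->
  (exists2 r : R, 0 < r & forall c, cabs c < r -> Z (z + c *: v)) \/
  (exists2 r : R, 0 < r & forall c, 0 < cabs c < r -> ~ Z (z + c *: v)).

Lemma line_dichotomyU O Z1 Z2 :
  line_dichotomy O Z1 -> line_dichotomy O Z2 -> line_dichotomy O (Z1 `|` Z2).
Proof.
move=> H1 H2 z v Oz.
have [[r r0 Hr]|[r1 r10 Hr1]] := H1 z v Oz.
  by left; exists r => // c /Hr; left.
have [[r r0 Hr]|[r2 r20 Hr2]] := H2 z v Oz.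
  by left; exists r => // c /Hr; right.
right; exists (Num.min r1 r2); first by rewrite lt_min r10.
move=> c /andP[c0]; rewrite lt_min => /andP[c1 c2] [] ZZ.
  by apply: (Hr1 c); rewrite ?c0.
by apply: (Hr2 c); rewrite ?c0.
Qed.

(* Identity theorem: by the dichotomy, the parameters around which [Z] is full form an open and closed subset of the segment. *)
Lemma line_dichotomy_propagate O Z z z' : convex_domain O -> line_dichotomy O Z ->
  tube O z -> tube O z' -> ~ Z z' ->
  exists2 r : R, 0 < r & forall c, 0 < cabs c < r -> ~ Z (z + c *: (z' - z)).
Proof.
move=> [_ [_ [_ cO]]] dZ Oz Oz' nZ.
pose v := z' - z; rewrite -/v.
have [full|//] := dZ z v Oz; exfalso.
pose fullat (t : R) := exists2 r : R, 0 < r & forall c, cabs (c - (t%:C)%C) < r -> Z (z + c *: v).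
have On (t : R) : 0 <= t <= 1 -> tube O (z + (t%:C)%C *: v).
  move=> t01; have := cO _ _ Oz Oz' t t01; rewrite /tube /=.
  congr (O _); apply/rowP => i; rewrite !mxE.
  case: (z ord0 i) (z' ord0 i) => [x1 y1] [x2 y2] /=; ring.
have dich (t : R) : 0 <= t <= 1 -> fullat t \/
    (exists2 r : R, 0 < r & forall c, 0 < cabs (c - (t%:C)%C) < r -> ~ Z (z + c *: v)).
  move=> /On Ot; have E c : z + (t%:C)%C *: v + (c - (t%:C)%C) *: v = z + c *: v.
    by rewrite -addrA -scalerDl [(t%:C)%C + _]addrC subrK.
  have [[r r0 H]|[r r0 H]] := dZ _ v Ot; [left|right]; exists r => // c /H; by rewrite E.
(* Quantifying over all [s <= t] makes [S] an interval starting at 0, so fullness holds everywhere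
   below its supremum. *)
pose S := [set t : R | 0 <= t <= 1 /\ forall s : R, 0 <= s <= t -> fullat s].
have f0 : fullat 0.
  by case: full => r r0 H; exists r => // c; rewrite subr0; exact: H.
have S0 : S 0.
  by split; [rewrite lexx ler01|move=> s s0; have -> : s = 0 by lra].
have Sub : ubound S 1 by move=> t [] /andP[].
have t0 : 0 <= sup S by apply: ub_le_sup => //; exists 1.
have t1 : sup S <= 1 by apply: ge_sup => //; exists 0.
have hs : has_sup S by split; [exists 0|exists 1].
have t01 : 0 <= sup S <= 1 by rewrite t0.
have below (s : R) : 0 <= s < sup S -> fullat s.
  move=> /andP[s0 ss]; have sp : 0 < sup S - s by rewrite subr_gt0.
  have [u [_ Hu] su] := sup_adherent sp hs.
  by apply: Hu; rewrite s0 /=; move: su; lra.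
(* At [sup S] isolation contradicts fullness at a parameter slightly below, or slightly above when
   [sup S] is 0. *)
have [[r r0 H]|[r r0 H]] := dich (sup S) t01; last first.
  have [E|Ne] := eqVneq (sup S) 0.
    case: f0 => r' r'0 H'; pose x : R := Num.min r r' / 2.
    have x0 : 0 < x by rewrite divr_gt0 // lt_min r0.
    have [xr xr'] : x < r /\ x < r'.
      have : Num.min r r' <= r by rewrite ge_min lexx.
      have : Num.min r r' <= r' by rewrite ge_min lexx orbT.
      by move: x0; rewrite /x; lra.
    apply: (H (x%:C)%C); first by rewrite E subr0 cabs_real ger0_norm ?x0 // ltW.
    by apply: H'; rewrite subr0 cabs_real ger0_norm // ltW.
  have s0 : 0 < sup S by rewrite lt_def Ne.
  pose s : R := Num.max (sup S / 2) (sup S - r / 2).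
  have [s1 s2] : sup S / 2 <= s /\ sup S - r / 2 <= s.
    by rewrite /s; split; rewrite le_max lexx ?orbT.
  have s3 : s < sup S by rewrite gt_max; apply/andP; split; lra.
  have [r' r'0 H'] := below s (ltac:(by apply/andP; split; lra)).
  apply: (H (s%:C)%C); last by apply: H'; rewrite subrr cabs0.
  rewrite -rmorphB cabs_real distrC ger0_norm; last by lra.
  by apply/andP; split; lra.
have fullr (s : R) : `|s - sup S| < r -> fullat s.
  move=> sr; exists (r - `|s - sup S|); first by rewrite subr_gt0.
  move=> c cs; apply: H; have := cabs_distD (s%:C)%C c ((sup S)%:C)%C.
  by rewrite -rmorphB cabs_real; lra.
have [lt1|ge1] := ltP (sup S) 1.
  pose t : R := Num.min 1 (sup S + r / 2).
  have [ta tb] : t <= 1 /\ t <= sup S + r / 2.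
    by rewrite /t; split; rewrite ge_min lexx ?orbT.
  have tc : sup S < t by rewrite lt_min lt1 ltrDl divr_gt0.
  have : S t.
    split; first by rewrite ta andbT; lra.
    move=> s /andP[s0 st]; have [ss|ss] := ltP s (sup S); first by apply: below; rewrite s0.
    by apply: fullr; rewrite ger0_norm ?subr_ge0 //; lra.
  move=> /(ub_le_sup (ex_intro _ 1 Sub)); lra.
have [r' r'0 H'] := fullr 1 (ltac:(by rewrite (_ : 1 - sup S = 0) ?normr0 //; lra)).
apply: nZ; have := H' 1; rewrite subrr cabs0 scale1r /v addrC subrK; exact.
Qed.

(** Induction on the list: from a point [z1] avoiding the earlier sets, a small move towards a point
    outside [Z l] leaves [Z l] by propagation and still avoids the others, whose union is isolated
    along the line because [z1] is not in it. *)
Lemma line_dichotomy_avoid (I : eqType) (s : seq I) O (Z : I -> set 'rV[R[i]]_m) :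
  convex_domain O -> (forall l, line_dichotomy O (Z l)) ->
  (forall l, exists2 z, tube O z & ~ Z l z) ->
  (exists2 z, tube O z & forall l, l \in s -> ~ Z l z) /\
  line_dichotomy O [set z | exists2 l, l \in s & Z l z].
Proof.
move=> cO dZ exZ; elim: s => [|l s [[z1 Oz1 H1] dU]].
  split; last by move=> z v _; right; exists 1 => // c _ [].
  by have [[y Oy] _] := cO; exists (\row_i (Complex 0 (y ord0 i))) => //;
    rewrite /tube /= (_ : im_part _ = y) //; apply/rowP => i; rewrite !mxE.
have dU' : line_dichotomy O [set z | exists2 l0, l0 \in l :: s & Z l0 z].
  rewrite (_ : mkset _ = Z l `|` [set z | exists2 l0, l0 \in s & Z l0 z]); first exact: line_dichotomyU.
  apply/seteqP; split=> z /=.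
    by move=> [l0]; rewrite inE => /orP[/eqP->|]; [left|right; exists l0].
  move=> [H|[l0 ls H]]; first by exists l; rewrite ?mem_head.
  by exists l0; rewrite // inE ls orbT.
split=> //.
have [z2 Oz2 H2] := exZ l.
have [r r0 Hr] := line_dichotomy_propagate cO (dZ l) Oz1 Oz2 H2.
have [[r' r'0 Hr']|[r' r'0 Hr']] := dU z1 (z2 - z1) Oz1.
  have [l0 l0s] := Hr' 0 (ltac:(by rewrite cabs0)).
  by rewrite scale0r addr0 => /(H1 _ l0s).
have [_ [oO _]] := cO.
have [t t0 [Q rQ Ht]] := tube_box oO Oz1.
have [t' t'0 Ht'] := snear_line z1 (z2 - z1) 0 t0.
pose x : R := Num.min (Num.min r r') t' / 2.
have x0 : 0 < x by rewrite divr_gt0 // !lt_min r0 r'0.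
have [[xr xr'] xt'] : (x < r /\ x < r') /\ x < t'.
  have : Num.min (Num.min r r') t' <= r by rewrite !ge_min lexx.
  have : Num.min (Num.min r r') t' <= r' by rewrite !ge_min lexx !orbT.
  have : Num.min (Num.min r r') t' <= t' by rewrite !ge_min lexx !orbT.
  by move: x0; rewrite /x; lra.
have cx : cabs (x%:C)%C = x by rewrite cabs_real ger0_norm // ltW.
exists (z1 + (x%:C)%C *: (z2 - z1)).
  apply: relcpt_tube rQ _; apply: Ht.
  by have := Ht' (x%:C)%C; rewrite scale0r addr0 subr0 cx; apply.
move=> l0; rewrite inE => /orP[/eqP->|l0s]; first by apply: Hr; rewrite cx x0.
by move=> ZZ; apply: (Hr' (x%:C)%C); [rewrite cx x0|exists l0].
Qed.

End Tube.

(** * Limits of translates *)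

Lemma ord_common_radius (R : realType) n (Q : 'I_n -> R -> Prop) :
  (forall l (r r' : R), r' <= r -> Q l r -> Q l r') ->
  (forall l, exists2 r : R, 0 < r & Q l r) -> exists2 r : R, 0 < r & forall l, Q l r.
Proof.
move=> mono H.
have /choice[rf Hrf] : forall l, exists r : R, 0 < r /\ Q l r.
  by move=> l; have [r r0 Qr] := H l; exists r.
have S0 : 0 <= \sum_(l < n) (rf l)^-1.
  by apply: sumr_ge0 => l _; rewrite invr_ge0 ltW //; have [] := Hrf l.
(* This number lies below every [rf l], and the [+ 1] keeps it positive when [n] is 0. *)
exists (\sum_(l < n) (rf l)^-1 + 1)^-1; first by rewrite invr_gt0; lra.
move=> l; have [r0 Ql] := Hrf l; apply: mono Ql.
rewrite invf_ple ?posrE //; last by lra.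
rewrite (bigD1 l) //=; have : 0 <= \sum_(i < n | i != l) (rf i)^-1.
  by apply: sumr_ge0 => j _; rewrite invr_ge0 ltW //; have [] := Hrf j.
lra.
Qed.

Section Families.
Variables (R : realType) (m k : nat).
Local Notation V := 'rV[R[i]]_m.
Local Notation W := 'rV[R[i]]_k.+1.
Implicit Types (O : set 'rV[R]_m) (A B : nat -> V -> W) (P : V -> W).

Local Notation K := ((k.+1)%:R : R).
Local Notation C := (6 * K ^+ 2).

Let K1 : 1 <= K. Proof. by rewrite ler1n. Qed.

Let C1 : 1 <= C.
Proof.
have KK : K <= K ^+ 2 by rewrite expr2 ler_peMr // K1.
have := K1; lra.
Qed.

Definition wconv O A P : Prop := forall O', relcpt O' O -> forall e : R, 0 < e ->
  exists N, forall n, (N <= n)%N -> forall z, tube O' z -> wclose (A n z) (P z) e.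

Definition limit_family O A P : Prop :=
  [/\ forall n l, holo (tube O) (fun z => A n z ord0 l),
      forall n z, tube O z -> A n z != 0,
      forall z, tube O z -> P z != 0 & wconv O A P].

Lemma holo_coords_cont O (a : V -> W) z (e : R) : (forall l, holo (tube O) (fun z => a z ord0 l)) ->
  tube O z -> a z != 0 -> 0 < e ->
  exists2 r : R, 0 < r & forall w, snear z r w -> tube O w -> wclose (a w) (a z) e.
Proof.
move=> ha Oz a0 e0; have [d d0 Hd] := wclose_near a0 e0.
have [||r r0 Hr] := @ord_common_radius R k.+1
  (fun l r => forall w, snear z r w -> tube O w -> cabs (a w ord0 l - a z ord0 l) <= d).
- by move=> l r r' rr H w zw; apply: H; exact: snearW zw.
- by move=> l; exact: holo_cont (ha l) Oz d0.
by exists r => // w zw Ow; apply: Hd => l; exact: Hr.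
Qed.

Lemma wclose_chain (a b c d : W) (e : R) : b != 0 -> c != 0 -> 0 <= e -> C * e <= 1 ->
  wclose a b e -> wclose b c e -> wclose c d e -> wclose a d (C * (C * e)).
Proof.
move=> b0 c0 e0 Ce ab bc cd.
have eC : e <= C * e by rewrite ler_peMl // C1.
have ac : wclose a c (C * e).
  apply: (wclose_trans b0) ab (wclose_sym bc).
  by rewrite e0 /=; lra.
apply: (wclose_trans c0) ac (wcloseW eC (wclose_sym cd)).
by rewrite Ce andbT mulr_ge0 //; have := C1; lra.
Qed.

(* Equicontinuity: one member of the family close to the limit transfers its own continuity to the limit. *)
Lemma limit_family_near O A P z (e : R) : open O -> limit_family O A P -> tube O z -> 0 < e ->
  exists2 r : R, 0 < r & exists N, forall w, snear z r w -> tube O w /\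
    forall n, (N <= n)%N -> wclose (A n w) (P z) e.
Proof.
move=> oO [hA A0 P0 cA] Oz e0.
have C0 : 0 < C by have := C1; lra.
(* Three uses of transitivity cost a factor [C] each, with one factor to spare; the minimum with 1
   keeps the intermediate constants at most 1. *)
pose e1 : R := Num.min 1 e / C ^+ 4.
have M0 : 0 < Num.min 1 e by rewrite lt_min ltr01 e0.
have e10 : 0 < e1 by rewrite divr_gt0 // exprn_gt0.
have e1E : C * (C * (C * (C * e1))) = Num.min 1 e.
  by rewrite /e1; field; rewrite gt_eqF //; have := K1; lra.
have e1le (x : R) : 0 <= x -> x <= C * x by move=> x0; rewrite ler_peMl // C1.
have [m1 me] : Num.min 1 e <= 1 /\ Num.min 1 e <= e.
  by split; rewrite ge_min lexx ?orbT.
have p1 := ltW e10; have p2 := mulr_ge0 (ltW C0) p1.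
have p3 := mulr_ge0 (ltW C0) p2; have p4 := mulr_ge0 (ltW C0) p3.
have [q1 [q2 [q3 q4]]] := (e1le _ p1, (e1le _ p2, (e1le _ p3, e1le _ p4))).
have [s s0 [Q rQ HQ]] := tube_box oO Oz.
have [N HN] := cA Q rQ e1 e10.
have QT w : snear z s w -> tube O w by move=> /HQ /(relcpt_tube rQ).
have [r r0 Hr] := holo_coords_cont (hA N) Oz (A0 N z Oz) e10.
exists (Num.min s r); first by rewrite lt_min s0.
exists N => w zw.
have zs : snear z s w by apply: snearW zw; rewrite ge_min lexx.
have zr : snear z r w by apply: snearW zw; rewrite ge_min lexx orbT.
have Ow := QT w zs; split=> // n Nn.
have zz : snear z s z by exact: snear_refl.
have T1 : wclose (P w) (P z) (C * (C * e1)).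
  apply: (@wclose_chain _ (A N w) (A N z)); rewrite ?A0 //.
  - by move: e1E; lra.
  - by apply/wclose_sym; apply: HN => //; exact: HQ.
  - exact: Hr.
  - by apply: HN => //; exact: HQ.
have T2 : wclose (A n w) (P z) (C * (C * (C * e1))).
  apply: (wclose_trans (P0 w Ow)).
  - by rewrite p3 /=; lra.
  - by apply: wcloseW (HN n Nn w (HQ w zs)); lra.
  - exact: wclose_sym.
by apply: wcloseW T2; lra.
Qed.

Lemma wclose_coord_lower (a g : W) (t : R) l : a != 0 -> g != 0 -> 0 < t ->
  vnorm g <= t * cabs (g ord0 l) -> wclose a g (2 * K * t)^-1 ->
  vnorm a <= 2 * K * t * cabs (a ord0 l).
Proof.
move=> a0 g0 t0 gl W1.
have K0 : 0 < K by rewrite ltr0n.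
have := @wclose_lower R k.+1 a g _ t^-1 l a0 g0 W1.
rewrite ler_pdivrMl // invr_ge0 => /(_ gl (ltW t0)).
have -> : t^-1 - K / (2 * K * t) = (2 * t)^-1 by field; rewrite !gt_eqF.
rewrite ler_pdivrMl ?mulr_gt0 // => H; apply: le_trans H _.
by rewrite le_eqVlt; apply/orP; left; apply/eqP; ring.
Qed.

(** Near [z] one coordinate [i0] dominates in [P] and in all late members of the family. The ratio
    of the coordinates [l] and [i0] of [P] does not depend on the choice of homogeneous coordinates
    and is a uniform limit of holomorphic ratios, so its zeros along a line are isolated or fill a
    disc. *)
Lemma limit_family_dichotomy O A P l : open O -> limit_family O A P ->
  line_dichotomy O [set z | P z ord0 l = 0].
Proof.
move=> oO lf z v Oz; have [hA A0 P0 cA] := lf.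
have K0 : 0 < K by rewrite ltr0n.
have [i0 Hi0] := vnorm_coord_ex (P0 z Oz).
pose t : R := 2 * K * K; have t0 : 0 < t by rewrite !mulr_gt0.
have [r r0 [N HN]] := limit_family_near oO lf Oz (ltac:(by rewrite invr_gt0) : 0 < t^-1).
have [s s0 [Q rQ HQ]] := tube_box oO Oz.
have [rho rho0 Hrho] := snear_line z v 0 (ltac:(by rewrite lt_min r0 s0) : 0 < Num.min r s).
have near c : cabs c < rho -> [/\ snear z r (z + c *: v), tube Q (z + c *: v) & tube O (z + c *: v)].
  move=> cr; have := Hrho c; rewrite subr0 scale0r addr0 => /(_ cr) H.
  have H1 : snear z r (z + c *: v) by apply: snearW H; rewrite ge_min lexx.
  have H2 : snear z s (z + c *: v) by apply: snearW H; rewrite ge_min lexx orbT.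
  by split=> //; [exact: HQ | exact: (HN _ H1).1].
have Alow n c : (N <= n)%N -> cabs c < rho ->
   vnorm (A n (z + c *: v)) <= t * cabs (A n (z + c *: v) ord0 i0).
  move=> Nn /near[H1 _ Oc]; apply: wclose_coord_lower (P0 z Oz) K0 Hi0 _; first exact: A0.
  exact: (HN _ H1).2.
pose t2 : R := 2 * K * t; have t20 : 0 < t2 by rewrite !mulr_gt0.
have Plow c : cabs c < rho -> vnorm (P (z + c *: v)) <= t2 * cabs (P (z + c *: v) ord0 i0).
  move=> cr; have [H1 Qc Oc] := near c cr.
  have [M HM] := cA Q rQ _ (ltac:(by rewrite invr_gt0) : 0 < t2^-1).
  apply: (wclose_coord_lower (P0 _ Oc) (A0 (maxn N M) _ Oc) t0).
    by apply: Alow => //; exact: leq_maxl.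
  by apply/wclose_sym/HM => //; exact: leq_maxr.
have gt0_of (x : W) (u : R) i : x != 0 -> 0 < u -> vnorm x <= u * cabs (x ord0 i) -> 0 < cabs (x ord0 i).
  rewrite -vnorm_gt0 => x0 u0 H.
  by have := lt_le_trans x0 H; rewrite pmulr_rgt0.
pose f c := P (z + c *: v) ord0 l / P (z + c *: v) ord0 i0.
(* The shift by [N] discards the members whose denominator might vanish. *)
pose F n c := A (n + N)%N (z + c *: v) ord0 l / A (n + N)%N (z + c *: v) ord0 i0.
have AN0 n c : cabs c < rho -> 0 < cabs (A (n + N)%N (z + c *: v) ord0 i0).
  move=> cr; have [_ _ Oc] := near c cr.
  by apply: (gt0_of _ t) => //; [exact: A0 | apply: Alow => //; exact: leq_addl].
have PN0 c : cabs c < rho -> 0 < cabs (P (z + c *: v) ord0 i0).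
  move=> cr; have [_ _ Oc] := near c cr.
  by apply: (gt0_of _ t2) => //; [exact: P0 | exact: Plow].
have df c : cabs c < rho -> cdiff f c.
  move=> cr; pose rr : R := rho - cabs c; have rr0 : 0 < rr by rewrite subr_gt0.
  have rrP d : cabs (d - c) < rr -> cabs d < rho.
    exact: cabs_ball_sub.
  apply: (@uniform_limit_cdiff R F f c rr) => //.
  - move=> n d /rrP dr.
    have dd : 0 < rho - cabs d by rewrite subr_gt0.
    have Od d' : cabs (d' - d) < rho - cabs d -> tube O (z + d' *: v).
      by move=> /cabs_ball_sub /near[].
    apply: cdiffM; first exact: holo_line (hA _ l) dd Od.
    apply: cdiffV; first by rewrite -cabs_gt0 AN0.
    exact: holo_line (hA _ i0) dd Od.
  move=> e e0; have [M HM] := cA Q rQ _ (ltac:(by rewrite divr_gt0 // mulr_gt0) : 0 < e / (t * t2)).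
  exists M => n Mn d /rrP dr; have [_ Qd Od] := near d dr.
  have [a0 p0] := (AN0 n d dr, PN0 d dr).
  have W1 := HM (n + N)%N (leq_trans Mn (leq_addr _ _)) _ Qd l i0.
  have L1 := Alow (n + N)%N d (leq_addl _ _) dr; have L2 := Plow d dr.
  rewrite /F /f; set a := A _ _ in W1 L1 a0 *; set p := P _ in W1 L2 p0 *.
  have -> : a ord0 l / a ord0 i0 - p ord0 l / p ord0 i0 =
     (a ord0 l * p ord0 i0 - a ord0 i0 * p ord0 l) / (a ord0 i0 * p ord0 i0).
    by field; rewrite -!cabs_gt0 a0 p0.
  rewrite cabsM cabsV cabsM ler_pdivrMr ?mulr_gt0 //; apply: le_trans W1 _.
  have -> : e * (cabs (a ord0 i0) * cabs (p ord0 i0)) =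
     e / (t * t2) * ((t * cabs (a ord0 i0)) * (t2 * cabs (p ord0 i0))).
    by field; rewrite !gt_eqF.
  apply: ler_wpM2l; first by rewrite ltW // divr_gt0 // mulr_gt0.
  by rewrite ler_pM ?vnorm_ge0.
have [|[x x0 Hx]|[x x0 Hx]] := @isolated_zeros R f 0 rho rho0.
- by move=> c; rewrite subr0; exact: df.
- left; exists (Num.min x rho); first by rewrite lt_min x0.
  move=> c; rewrite lt_min => /andP[cx cr]; have := Hx c; rewrite subr0 => /(_ cx) /eqP.
  by rewrite /f mulf_eq0 invr_eq0 => /orP[/eqP //|]; rewrite -cabs_eq0 gt_eqF // PN0.
- right; exists (Num.min x rho); first by rewrite lt_min x0.
  move=> c /andP[c0]; rewrite lt_min => /andP[cx cr] Pc.
  have := Hx c; rewrite subr0 c0 cx => /(_ isT).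
  by rewrite /f Pc mul0r eqxx.
Qed.

(** Compactness of the circle makes the bound uniform. A single number [N] acts as first index, as
    constant and, through its inverse, as radius for the centre [w]; all three conditions relax as
    [N] grows, so one eventual statement suffices for the covering argument. *)
Lemma circle_lower O A P z v (rho : R) l : open O -> limit_family O A P ->
  (forall c, cabs c = rho -> tube O (z + c *: v) /\ P (z + c *: v) ord0 l != 0) ->
  exists N : nat, forall n, (N <= n)%N -> forall w, snear z ((N.+1)%:R^-1) w ->
    forall c, cabs c = rho -> vnorm (A n (w + c *: v)) <= N%:R * cabs (A n (w + c *: v) ord0 l).
Proof.
move=> oO lf HP; have [hA A0 P0 cA] := lf.
have K0 : 0 < K by rewrite ltr0n.
pose S := [set p : R * R | [set rho] (cabs (Complex p.1 p.2))].
have cS : compact S.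
  by apply: (@compact_cabs R [set rho] rho); [exact: (@closed_eq _ rho) | move=> x ->].
pose G (N : nat) (p : R * R) := forall n, (N <= n)%N -> forall w, snear z ((N.+1)%:R^-1) w ->
  vnorm (A n (w + Complex p.1 p.2 *: v)) <= N%:R * cabs (A n (w + Complex p.1 p.2 *: v) ord0 l).
have : \forall N \near \oo, S `<=` G N.
  move/compact_near_coveringP : cS => cover; apply: cover => p Sp.
  have [Op Pp] := HP _ Sp.
  pose c := Complex p.1 p.2; rewrite -/c in Op Pp.
  pose t : R := vnorm (P (z + c *: v)) / cabs (P (z + c *: v) ord0 l).
  have t0 : 0 < t by rewrite divr_gt0 ?vnorm_gt0 ?P0 // cabs_gt0.
  have Kt : 0 < 2 * K * t by rewrite mulr_gt0 // mulr_gt0.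
  have [r r0 [N1 HN1]] := limit_family_near oO lf Op (ltac:(by rewrite invr_gt0) : 0 < (2 * K * t)^-1).
  have r2 : 0 < r / 2 by rewrite divr_gt0.
  have [s s0 Hs] := snear_line z v c r2.
  pose N2 := Num.bound (2 / r); pose N3 := Num.bound (2 * K * t).
  have B2 : 2 / r < N2%:R by apply: archi_boundP; rewrite divr_ge0 // ltW.
  have B3 : 2 * K * t < N3%:R by apply: archi_boundP; rewrite ltW.
  have s2 : 0 < s / 2 by rewrite divr_gt0.
  exists ((ball p.1 (s / 2) `*` ball p.2 (s / 2)), [set N | (maxn N1 (maxn N2 N3) <= N)%N]).
    split; last by exists (maxn N1 (maxn N2 N3)).
    by exists (ball p.1 (s / 2), ball p.2 (s / 2)) => //; split; exact: nbhsx_ballx.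
  move=> [q N] [/= [b1 b2] HN] n Nn w zw /=.
  move: HN; rewrite !geq_max => /andP[L1 /andP[L2 L3]].
  have near : snear (z + c *: v) r (w + Complex q.1 q.2 *: v).
    have D : cabs (Complex q.1 q.2 - c) < s.
      apply: le_lt_trans (cabs_le_ReIm _) _; move: b1 b2; rewrite /ball /= => b1 b2.
      by rewrite distrC in b1; rewrite distrC in b2; lra.
    have H1 := Hs _ D.
    have H2 : snear (z + Complex q.1 q.2 *: v) (r / 2) (w + Complex q.1 q.2 *: v).
      move=> i; rewrite !mxE opprD addrACA subrr addr0; apply: lt_le_trans (zw i) _.
      rewrite -[leRHS]invrK lef_pV2 ?posrE ?invr_gt0 ?ltr0n //.
      rewrite invf_div; apply: (le_trans (ltW B2)); rewrite ler_nat.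
      by apply: leq_trans L2 _.
    by apply: snear_trans H1 H2; lra.
  have [Ow Hw] := HN1 _ near.
  apply: (@le_trans _ _ (2 * K * t * cabs (A n (w + Complex q.1 q.2 *: v) ord0 l))).
    apply: (wclose_coord_lower (A0 _ _ Ow) (P0 _ Op) t0).
      by rewrite /t divfK // gt_eqF // cabs_gt0.
    by apply: Hw; exact: leq_trans L1 Nn.
  rewrite ler_wpM2r ?cabs_ge0 //; apply: (le_trans (ltW B3)); rewrite ler_nat.
  exact: L3.
move=> [N _ HN]; exists N => n Nn w zw [x y] cr.
by apply: (HN N (leqnn N) (x, y)).
Qed.

End Families.

(** * Comparison of two product families *)

Section Translates.
Variables (R : realType) (m k : nat).
Local Notation V := 'rV[R[i]]_m.
Local Notation W := 'rV[R[i]]_k.+1.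
Implicit Types (O : set 'rV[R]_m) (A B : nat -> V -> W) (P : V -> W).

Lemma limit_family_close O A B P O' (e : R) :
  limit_family O A P -> limit_family O B P -> relcpt O' O -> 0 < e ->
  exists N, forall n, (N <= n)%N -> forall z, tube O' z -> wclose (A n z) (B n z) e.
Proof.
move=> [_ _ P0 cA] [_ _ _ cB] rO e0.
pose C : R := 6 * k.+1%:R ^+ 2.
have C1 : 1 <= C.
  have k1 : 1 <= k.+1%:R :> R by rewrite ler1n.
  have : 1 <= k.+1%:R ^+ 2 :> R by rewrite exprn_ege1.
  by rewrite /C; lra.
pose e1 : R := Num.min 1 (e / C).
have e10 : 0 < e1 by rewrite lt_min ltr01 divr_gt0 //; lra.
have [e11 eC] : e1 <= 1 /\ C * e1 <= e.
  by rewrite mulrC -ler_pdivlMr; [rewrite /e1; split; rewrite ge_min lexx ?orbT|lra].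
have [N1 H1] := cA _ rO _ e10; have [N2 H2] := cB _ rO _ e10.
exists (maxn N1 N2) => n; rewrite geq_max => /andP[n1 n2] z Oz.
apply: wcloseW eC _; apply: (wclose_trans (P0 z (relcpt_tube rO Oz))).
- by rewrite (ltW e10).
- exact: H1.
- exact: H2.
Qed.

Lemma limit_family_sub O A P (psi : nat -> nat) : (forall n, (n <= psi n)%N) ->
  limit_family O A P -> limit_family O (fun n => A (psi n)) P.
Proof.
move=> Hpsi [hA A0 P0 cA]; split=> [n l|n z Oz||O' rO e e0]; [exact: hA|exact: A0|exact: P0|].
have [N HN] := cA O' rO e e0; exists N => n Nn; apply: HN.
exact: leq_trans Nn (Hpsi n).
Qed.

(** The minor of the products splits into a minor of [a], [b] and one of [c], [d]. A bound by the
    four norms alone would be useless, since a product vector can be much shorter than the product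
    of the norms; coordinates comparable to the norms repair this. *)
Lemma product_wedge (a b c d : W) (eta kap : R) i j l l' : 0 <= eta -> 0 < kap ->
  wclose a b eta -> wclose c d eta ->
  vnorm a <= kap * cabs (a ord0 l) -> vnorm c <= kap * cabs (c ord0 l) ->
  vnorm b <= kap * cabs (b ord0 l') -> vnorm d <= kap * cabs (d ord0 l') ->
  cabs (a ord0 i * c ord0 i * (b ord0 j * d ord0 j) - a ord0 j * c ord0 j * (b ord0 i * d ord0 i))
    <= 2 * eta * kap ^+ 4 * cabs (a ord0 l * c ord0 l * (b ord0 l' * d ord0 l')).
Proof.
move=> eta0 kap0 Wab Wcd La Lc Lb Ld.
have [na nb nc nd] : [/\ 0 <= vnorm a, 0 <= vnorm b, 0 <= vnorm c & 0 <= vnorm d].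
  by rewrite !vnorm_ge0.
have bound : cabs (a ord0 i * c ord0 i * (b ord0 j * d ord0 j) - a ord0 j * c ord0 j * (b ord0 i * d ord0 i))
   <= 2 * eta * (vnorm a * vnorm c * (vnorm b * vnorm d)).
  have -> : a ord0 i * c ord0 i * (b ord0 j * d ord0 j) - a ord0 j * c ord0 j * (b ord0 i * d ord0 i) =
    (a ord0 i * b ord0 j - a ord0 j * b ord0 i) * (c ord0 i * d ord0 j) +
    (a ord0 j * b ord0 i) * (c ord0 i * d ord0 j - c ord0 j * d ord0 i) by ring.
  apply: le_trans (cabsD _ _) _.
  have T1 : cabs ((a ord0 i * b ord0 j - a ord0 j * b ord0 i) * (c ord0 i * d ord0 j)) <=
     eta * (vnorm a * vnorm b) * (vnorm c * vnorm d).
    by rewrite cabsM cabsM !ler_pM ?mulr_ge0 ?cabs_ge0 ?cabs_le_vnorm //; exact: Wab.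
  have T2 : cabs ((a ord0 j * b ord0 i) * (c ord0 i * d ord0 j - c ord0 j * d ord0 i)) <=
     vnorm a * vnorm b * (eta * (vnorm c * vnorm d)).
    by rewrite cabsM cabsM !ler_pM ?mulr_ge0 ?cabs_ge0 ?cabs_le_vnorm //; exact: Wcd.
  lra.
apply: (le_trans bound); rewrite !cabsM.
have -> : 2 * eta * kap ^+ 4 * (cabs (a ord0 l) * cabs (c ord0 l) * (cabs (b ord0 l') * cabs (d ord0 l')))
  = 2 * eta * (kap * cabs (a ord0 l) * (kap * cabs (c ord0 l)) *
     (kap * cabs (b ord0 l') * (kap * cabs (d ord0 l')))) by ring.
by rewrite ler_wpM2l ?mulr_ge0 // !ler_pM ?mulr_ge0.
Qed.

Lemma circle_lower_all O A P z v (rho : R) : open O -> limit_family O A P ->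
  (forall l c, cabs c = rho -> tube O (z + c *: v) /\ P (z + c *: v) ord0 l != 0) ->
  exists N : nat, forall n, (N <= n)%N -> forall w, snear z ((N.+1)%:R^-1) w ->
    forall l c, cabs c = rho ->
      vnorm (A n (w + c *: v)) <= N%:R * cabs (A n (w + c *: v) ord0 l).
Proof.
move=> oO lf HP.
have /choice[Nl HNl] := fun l => circle_lower oO lf (HP l).
pose N := (\max_l Nl l)%N; exists N => n Nn w zw l c cr.
have NlN : (Nl l <= N)%N by exact: leq_bigmax.
apply: le_trans (HNl l n (leq_trans NlN Nn) w _ c cr) _.
  by apply: snearW zw; rewrite lef_pV2 ?posrE ?ltr0n // ler_nat.
by rewrite ler_wpM2r ?cabs_ge0 // ler_nat.
Qed.

(* The wedge of the two products, divided by zero-free coordinates, is holomorphic on a disc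
   and small on its boundary circle, which avoids the zeros of the limits [P] and [Q]. *)
Lemma product_families_close O (A B C D ga gb : nat -> V -> W) (ha hb : nat -> V -> R[i]) P Q z0
    (del eta : R) :
  convex_domain O ->
  limit_family O A P -> limit_family O B P -> limit_family O C Q -> limit_family O D Q ->
  (forall l, exists2 z, tube O z & P z ord0 l != 0) ->
  (forall l, exists2 z, tube O z & Q z ord0 l != 0) ->
  (forall n l, holo (tube O) (fun z => ga n z ord0 l)) ->
  (forall n l, holo (tube O) (fun z => gb n z ord0 l)) ->
  (forall n l z, tube O z -> ga n z ord0 l * ha n z = A n z ord0 l * C n z ord0 l) ->
  (forall n l z, tube O z -> gb n z ord0 l * hb n z = B n z ord0 l * D n z ord0 l) ->
  tube O z0 -> 0 < del ->
  (forall n, exists l, forall w, tube O w -> vnorm (w - z0) < del -> ga n w ord0 l != 0) ->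
  (forall n, exists l, forall w, tube O w -> vnorm (w - z0) < del -> gb n w ord0 l != 0) ->
  0 < eta ->
  exists2 r : R, 0 < r & exists N, forall n, (N <= n)%N -> forall w, snear z0 r w ->
    wclose (ga n w) (gb n w) eta.
Proof.
move=> cO lA lB lC lD PN QN hga hgb relA relB Oz0 del0 zfA zfB eta0.
have oO : open O by case: cO => _ [].
(* The zero sets of all coordinates of [P] and [Q] form one finite family, to be avoided by a single
   circle. *)
pose Z (bl : bool * 'I_k.+1) : set V :=
  if bl.1 then [set z | P z ord0 bl.2 = 0] else [set z | Q z ord0 bl.2 = 0].
have dZ l : line_dichotomy O (Z l).
  case: l => [[] l]; first exact: limit_family_dichotomy lA.
  exact: limit_family_dichotomy lC.
have exZ l : exists2 z, tube O z & ~ Z l z.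
  case: l => [[] l]; [have [z Oz /eqP] := PN l|have [z Oz /eqP] := QN l]; by exists z.
have [[z' Oz' Hz'] dU] := line_dichotomy_avoid (enum {: bool * 'I_k.+1}) cO dZ exZ.
have nU : ~ [set z | exists2 l, l \in enum {: bool * 'I_k.+1} & Z l z] z'.
  by move=> [l ls]; exact: Hz'.
have [r1 r10 Hr1] := line_dichotomy_propagate cO dU Oz0 Oz' nU.
pose v := z' - z0; rewrite -/v in Hr1.
have [s1 s10 [Qs rQ HQ]] := tube_box oO Oz0.
have m1 : 0 < m%:R + 1 :> R by have : 0 <= m%:R :> R by []; lra.
(* One [s] is spent on moving the centre to [w], the other on moving along the line; [m + 1]
   converts coordinate bounds into a bound on [vnorm]. *)
pose s : R := Num.min s1 (del / (m%:R + 1)) / 2.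
have s0 : 0 < s by rewrite divr_gt0 // lt_min s10 divr_gt0.
have s2E : s + s = Num.min s1 (del / (m%:R + 1)) by rewrite /s; field.
have [sa sb] : s + s <= s1 /\ (s + s) * (m%:R + 1) <= del.
  by rewrite -ler_pdivlMr // s2E; split; rewrite ge_min lexx ?orbT.
have [rho2 rho20 Hrho2] := snear_line z0 v 0 s0.
have near w c : snear z0 s w -> cabs c < rho2 ->
    [/\ tube O (w + c *: v), tube Qs (w + c *: v) & vnorm (w + c *: v - z0) < del].
  move=> zw cr.
  have H2 : snear w s (w + c *: v).
    move=> i; have := Hrho2 c; rewrite subr0 => /(_ cr) /(_ i).
    by rewrite !mxE mul0r addr0 ![_ + c * _ - _]addrAC !subrr !add0r.
  have H3 := snear_trans (lexx _) zw H2.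
  have Qw : tube Qs (w + c *: v) by apply: HQ; exact: snearW H3.
  split=> //; first exact: relcpt_tube Qw.
  apply: (@le_lt_trans _ _ (m%:R * (s + s))); last by lra.
  apply: vnorm_le; first by lra.
  by move=> i; rewrite !mxE; have := H3 i; rewrite !mxE; exact: ltW.
pose rho : R := Num.min r1 rho2 / 2.
have rho0 : 0 < rho by rewrite divr_gt0 // lt_min r10.
have [rr1 rr2] : rho < r1 /\ rho < rho2.
  have : Num.min r1 rho2 <= r1 by rewrite ge_min lexx.
  have : Num.min r1 rho2 <= rho2 by rewrite ge_min lexx orbT.
  by move: rho0; rewrite /rho; lra.
have nzZ c l : cabs c = rho -> ~ Z l (z0 + c *: v).
  move=> cr ZZ; apply: (Hr1 c); first by rewrite cr rho0.
  by exists l; rewrite ?mem_enum.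
have OC c : cabs c = rho -> tube O (z0 + c *: v).
  by move=> cr; have [] := near z0 c (snear_refl z0 s0); rewrite // cr.
have nzP l c : cabs c = rho -> tube O (z0 + c *: v) /\ P (z0 + c *: v) ord0 l != 0.
  by move=> cr; split; [exact: OC|apply/eqP; exact: (nzZ c (true, l))].
have nzQ l c : cabs c = rho -> tube O (z0 + c *: v) /\ Q (z0 + c *: v) ord0 l != 0.
  by move=> cr; split; [exact: OC|apply/eqP; exact: (nzZ c (false, l))].
have [NA HA] := circle_lower_all oO lA nzP.
have [NB HB] := circle_lower_all oO lB nzP.
have [NC HC] := circle_lower_all oO lC nzQ.
have [ND HD] := circle_lower_all oO lD nzQ.
pose N := maxn (maxn NA NB) (maxn NC ND).
have [LA LB LC LD] : [/\ (NA <= N)%N, (NB <= N)%N, (NC <= N)%N & (ND <= N)%N].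
  by rewrite /N !leq_max !leqnn !orbT.
pose kap : R := N.+1%:R; have kap0 : 0 < kap by rewrite ltr0n.
have kapP (N' : nat) (x : R) : (N' <= N)%N -> 0 <= x -> N'%:R * x <= kap * x.
  by move=> h x0; rewrite ler_wpM2r // ler_nat (leq_trans h).
pose e : R := eta / (2 * kap ^+ 4).
have k4 : 0 < 2 * kap ^+ 4 by rewrite mulr_gt0 // exprn_gt0.
have e0 : 0 < e by rewrite divr_gt0.
have [N5 H5] := limit_family_close lA lB rQ e0.
have [N6 H6] := limit_family_close lC lD rQ e0.
exists (Num.min s kap^-1); first by rewrite lt_min s0 invr_gt0.
exists (maxn N (maxn N5 N6)) => n; rewrite !geq_max => /andP[/andP[/andP[nA nB] /andP[nC nD]] /andP[n5 n6]] w zw.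
have zs : snear z0 s w by apply: snearW zw; rewrite ge_min lexx.
have zN (N' : nat) : (N' <= N)%N -> snear z0 (N'.+1%:R^-1) w.
  move=> h; apply: snearW zw; rewrite ge_min; apply/orP; right.
  by rewrite lef_pV2 ?posrE ?ltr0n // ler_nat.
have [la Hla] := zfA n; have [lb Hlb] := zfB n.
have u0 : w + 0 *: v = w by rewrite scale0r addr0.
have ga0 c : cabs c < rho2 -> ga n (w + c *: v) ord0 la != 0.
  by move=> /(near w c zs)[Ou _ du]; exact: Hla.
have gb0 c : cabs c < rho2 -> gb n (w + c *: v) ord0 lb != 0.
  by move=> /(near w c zs)[Ou _ du]; exact: Hlb.
move=> i j.
pose num c := ga n (w + c *: v) ord0 i * gb n (w + c *: v) ord0 j
  - ga n (w + c *: v) ord0 j * gb n (w + c *: v) ord0 i.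
pose den c := ga n (w + c *: v) ord0 la * gb n (w + c *: v) ord0 lb.
have den0 c : cabs c < rho2 -> den c != 0.
  by move=> cr; rewrite mulf_neq0 ?ga0 ?gb0.
have dH c : cabs c < rho2 -> cdiff (fun c => num c / den c) c.
  move=> cr; have rr : 0 < rho2 - cabs c by rewrite subr_gt0.
  have Ou d : cabs (d - c) < rho2 - cabs c -> tube O (w + d *: v).
    by move=> /cabs_ball_sub /(near w d zs)[].
  have dga l : cdiff (fun c => ga n (w + c *: v) ord0 l) c by exact: holo_line (hga n l) rr Ou.
  have dgb l : cdiff (fun c => gb n (w + c *: v) ord0 l) c by exact: holo_line (hgb n l) rr Ou.
  apply: cdiffM; first by apply: cdiffB; exact: cdiffM.
  by apply: cdiffV; [exact: den0|exact: cdiffM].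
have main : cabs (num 0 / den 0) <= eta.
  apply: (@maximum_modulus R (fun c => num c / den c) 0 rho) => //.
  - by move=> c; rewrite subr0 => cr; apply/cdiff_cont/dH; exact: le_lt_trans cr rr2.
  - move=> c; rewrite subr0 => cr; exists (rho2 - cabs c).
      by rewrite subr_gt0; exact: lt_trans cr rr2.
    by move=> d /andP[_ /cabs_ball_sub]; exact: dH.
  - move=> c; rewrite subr0 => cr.
    have cr2 : cabs c < rho2 by rewrite cr.
    have [Ou Qu _] := near w c zs cr2.
    have d0 := den0 c cr2; rewrite cabsM cabsV ler_pdivrMr ?cabs_gt0 //.
    set u := w + c *: v in Ou Qu *.
    have XA := le_trans (HA n nA w (zN _ LA) la c cr) (kapP _ _ LA (cabs_ge0 _)).
    have XB := le_trans (HB n nB w (zN _ LB) lb c cr) (kapP _ _ LB (cabs_ge0 _)).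
    have XC := le_trans (HC n nC w (zN _ LC) la c cr) (kapP _ _ LC (cabs_ge0 _)).
    have XD := le_trans (HD n nD w (zN _ LD) lb c cr) (kapP _ _ LD (cabs_ge0 _)).
    rewrite -/u in XA XB XC XD.
    have PW := product_wedge i j (ltW e0) kap0 (H5 n n5 u Qu) (H6 n n6 u Qu) XA XC XB XD.
    have nz (X : nat -> V -> W) Y l : limit_family O X Y -> vnorm (X n u) <= kap * cabs (X n u ord0 l) ->
        X n u ord0 l != 0.
      move=> [_ X0 _ _] Xl; have := X0 n u Ou; rewrite -vnorm_gt0 => Xp.
      by rewrite -cabs_gt0; have := lt_le_trans Xp Xl; rewrite pmulr_rgt0.
    (* On the circle the factors [ha] and [hb] divide products of nonzero coordinates. Multiplying
       the minor and the denominator by them yields the expressions of [product_wedge]. *)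
    have hh : ha n u * hb n u != 0.
      apply/negP => /eqP hh.
      have : A n u ord0 la * C n u ord0 la * (B n u ord0 lb * D n u ord0 lb) = 0.
        by rewrite -relA // -relB // mulrACA hh mulr0.
      move/eqP; rewrite !mulf_eq0.
      by rewrite (negbTE (nz _ _ _ lA XA)) (negbTE (nz _ _ _ lB XB)) (negbTE (nz _ _ _ lC XC))
        (negbTE (nz _ _ _ lD XD)).
    rewrite -!(relA n) // -!(relB n) // in PW.
    have h0 : 0 < cabs (ha n u * hb n u) by rewrite cabs_gt0.
    rewrite -(ler_pM2r h0) -mulrA -!cabsM.
    have -> : num c * (ha n u * hb n u) =
       ga n u ord0 i * ha n u * (gb n u ord0 j * hb n u) - ga n u ord0 j * ha n u * (gb n u ord0 i * hb n u).
      by rewrite /num -/u; ring.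
    have -> : den c * (ha n u * hb n u) = ga n u ord0 la * ha n u * (gb n u ord0 lb * hb n u).
      by rewrite /den -/u; ring.
    have -> : eta = 2 * e * kap ^+ 4 by rewrite /e; field; rewrite gt_eqF.
    exact: PW.
  by rewrite subr0 cabs0 ltW.
have d0 : cabs (den 0) > 0 by rewrite cabs_gt0 den0 // cabs0.
move: main; rewrite cabsM cabsV ler_pdivrMr // /num /den u0 cabsM => main.
apply: le_trans main _; rewrite ler_wpM2l ?(ltW eta0) //.
by rewrite ler_pM ?cabs_ge0 ?cabs_le_vnorm.
Qed.

Lemma holo_hvec O (F : 'I_k.+1 -> V -> R[i]) (t : 'rV[R]_m) l : hol_map O F ->
  holo (tube O) (fun z => hvec F (z + realv t) ord0 l).
Proof.
move=> [hF _]; rewrite (_ : (fun z => _) = fun z => F l (z + realv t)).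
  exact: holo_shift.
by apply: funext => z; rewrite mxE.
Qed.

Lemma hvec_neq0 O (F : 'I_k.+1 -> V -> R[i]) z : hol_map O F -> tube O z -> hvec F z != 0.
Proof.
move=> [_ [F0 _]] /F0[l Fl]; apply: contraNneq Fl => F00.
by have := congr1 (fun x : W => x ord0 l) F00; rewrite /= !mxE => ->.
Qed.

Lemma strict_incr_ge (phi : nat -> nat) : (forall n, (phi n < phi n.+1)%N) ->
  forall n, (n <= phi n)%N.
Proof. by move=> H; elim=> // n IH; exact: leq_ltn_trans IH (H n). Qed.

Lemma almost_periodic_limit O (F : 'I_k.+1 -> V -> R[i]) (t : nat -> 'rV[R]_m) :
  hol_ap_map O F -> exists phi P, (forall n, (phi n < phi n.+1)%N) /\
    limit_family O (fun n z => hvec F (z + realv (t (phi n)))) P.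
Proof.
move=> [hF apF]; have [phi [P [Hphi [P0 HP]]]] := apF t.
exists phi, P; split=> //; split=> //.
- by move=> n l; exact: holo_hvec.
- by move=> n z Oz; apply: (hvec_neq0 hF); rewrite tube_realv.
move=> O' rO e e0; have [d d0 Hd] := @fs_dist_wclose R k.+1 e e0.
have [N HN] := HP O' rO d d0; exists N => n Nn z Oz.
by apply: Hd; exact: HN.
Qed.

(** If [F l] is nonzero at [z1], then [P] is tested at [z1] shifted by [- t N]. This point depends
    on the index [N], which is legitimate because the convergence is uniform in all real
    directions. *)
Lemma limit_family_translate_nonzero O (F : 'I_k.+1 -> V -> R[i]) (t : nat -> 'rV[R]_m) P l :
  hol_map O F -> limit_family O (fun n z => hvec F (z + realv (t n))) P ->
  exists2 z, tube O z & P z ord0 l != 0.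
Proof.
move=> hF [_ _ P0 cP]; apply: contrapT => H.
have Pl z : tube O z -> P z ord0 l = 0.
  by move=> Oz; apply/eqP/negP => /negP nz; apply: H; exists z.
have [z1 Oz1 Fl] := hF.2.2 l.
have F0 := hvec_neq0 hF Oz1; have n0 := F0; rewrite -vnorm_gt0 in n0.
have K0 : 0 < k.+1%:R :> R by rewrite ltr0n.
pose e : R := cabs (F l z1) / (2 * k.+1%:R * vnorm (hvec F z1)).
have Fl0 : 0 < cabs (F l z1) by rewrite cabs_gt0.
have e0 : 0 < e by rewrite divr_gt0 // !mulr_gt0.
have rO : relcpt [set im_part z1] O.
  by exists [set im_part z1]; split; [exact: compact_set1|split=> // y ->].
have [N HN] := cP _ rO e e0.
pose z := z1 + realv (- t N).
have zE : z + realv (t N) = z1.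
  apply/rowP => i; rewrite !mxE -addrA -rmorphD addNr.
  by rewrite rmorph0 addr0.
have Oz : tube O z by rewrite tube_realv.
have := HN N (leqnn N) z _; rewrite zE => W1.
have {}W1 : wclose (hvec F z1) (P z) e.
  by apply: W1; rewrite /z tube_realv.
have [j Pj] := vnorm_coord_ex (P0 z Oz).
have := W1 l j; rewrite Pl // mulr0 subr0 cabsM mxE => L1.
have Pz0 : 0 < vnorm (P z) by rewrite vnorm_gt0 P0.
have L2 : cabs (F l z1) * vnorm (P z) <= cabs (F l z1) * (k.+1%:R * cabs (P z ord0 j)).
  by rewrite ler_wpM2l ?cabs_ge0.
have L3 : k.+1%:R * (cabs (F l z1) * cabs (P z ord0 j)) <= k.+1%:R * (e * (vnorm (hvec F z1) * vnorm (P z))).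
  by rewrite ler_wpM2l.
have E : k.+1%:R * (e * (vnorm (hvec F z1) * vnorm (P z))) = cabs (F l z1) * vnorm (P z) / 2.
  by rewrite /e; field; rewrite !gt_eqF.
have : 0 < cabs (F l z1) * vnorm (P z) by rewrite mulr_gt0.
lra.
Qed.

End Translates.

(** * Almost periodicity of the product map *)

Section Main.
Variables (R : realType) (m k : nat).
Local Notation V := 'rV[R[i]]_m.
Local Notation W := 'rV[R[i]]_k.+1.
Implicit Types (O : set 'rV[R]_m).

Definition zero_separated O (g : 'I_k.+1 -> V -> R[i]) : Prop :=
  forall O', relcpt O' O -> exists2 delta : R, 0 < delta &
     forall z0, tube O' z0 ->
       (#|[pred l : 'I_k.+1 | `[< cball z0 delta `&` div_supp O (g l) !=set0 >]]| <= k)%N.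

Lemma relcpt_set1 O (y : 'rV[R]_m) : O y -> relcpt [set y] O.
Proof. by move=> Oy; exists [set y]; split; [exact: compact_set1|split=> // ? ->]. Qed.

(** At most [k] of the [k+1] zero sets meet a ball of the given radius, so some coordinate has no
    zeros there. The tube over the imaginary part of [z0] contains all real translates of [z0]: the
    radius is common to all [t], while [l] may vary with [t]. *)
Lemma zero_separated_at O g (z0 : V) : zero_separated O g -> tube O z0 ->
  exists2 d : R, 0 < d & forall t : 'rV[R]_m, exists l, forall w, tube O w ->
    vnorm (w - z0) < d -> g l (w + realv t) != 0.
Proof.
move=> sep Oz0; have [d d0 Hd] := sep _ (relcpt_set1 Oz0).
exists d => // t; have := Hd (z0 + realv t); rewrite tube_realv => /(_ erefl) card.
apply: contrapT => /forallNP H.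
suff E : #|[pred l : 'I_k.+1 | `[< cball (z0 + realv t) d `&` div_supp O (g l) !=set0 >]]| = k.+1.
  by move: card; rewrite E ltnn.
rewrite -[RHS]card_ord; apply: eq_card => l; rewrite !inE.
apply/asboolP; have /existsNP[w /not_implyP[Ow /not_implyP[wd /negP/negPn/eqP g0]]] := H l.
exists (w + realv t); split; last by split; rewrite ?tube_realv.
by rewrite /cball /= opprD addrACA subrr addr0.
Qed.

(** Regarding a map as its own limit makes the dichotomy for limit families available for zeros of
    its coordinates. *)
Lemma hol_map_constant_family O (F : 'I_k.+1 -> V -> R[i]) : hol_map O F ->
  limit_family O (fun=> hvec F) (hvec F).
Proof.
move=> hF; split.
- move=> _ l; rewrite (_ : (fun z => _) = F l); first exact: hF.1.
  by apply: funext => z; rewrite mxE.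
- by move=> _ z; exact: hvec_neq0.
- by move=> z; exact: hvec_neq0.
by move=> O' _ e e0; exists 0%N => n _ z _; apply: wclose_refl; exact: ltW.
Qed.

(** Separation excludes common zeros. No coordinate [g l] vanishes identically, because the zero
    sets of [F l] and [Ft l] do not cover the tube. *)
Lemma hol_map_product O F Ft h g : convex_domain O -> hol_map O F -> hol_map O Ft ->
  (forall l, holo (tube O) (g l)) ->
  (forall l z, tube O z -> g l z * h z = F l z * Ft l z) ->
  zero_separated O g -> hol_map O g.
Proof.
move=> cO hF hFt hg rel sep; have oO : open O by case: cO => _ [].
split=> //; split.
  move=> z Oz; have [d d0 /(_ 0)[l Hl]] := zero_separated_at sep Oz.
  exists l; have := Hl z Oz; rewrite (_ : realv 0 = 0) ?addr0; last first.
    by apply/rowP => i; rewrite !mxE.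
  by apply; rewrite subrr (_ : vnorm 0 = 0) //; apply/eqP; rewrite vnorm_eq0.
move=> l.
pose G (b : bool) := if b then F else Ft.
have hG b : hol_map O (G b) by case: b.
have dZ b : line_dichotomy O [set z | hvec (G b) z ord0 l = 0].
  by apply: limit_family_dichotomy => //; exact: hol_map_constant_family.
have exZ b : exists2 z, tube O z & ~ [set z | hvec (G b) z ord0 l = 0] z.
  by have [z Oz /eqP Gz] := (hG b).2.2 l; exists z; rewrite //= mxE.
have [[z Oz Hz] _] := line_dichotomy_avoid [:: true; false] cO dZ exZ.
have Fz : F l z != 0 by apply/eqP; have := Hz true isT; rewrite /= mxE.
have Ftz : Ft l z != 0 by apply/eqP; have := Hz false isT; rewrite /= mxE.
exists z => //; have := mulf_neq0 Fz Ftz; rewrite -rel //.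
by apply: contraNneq => ->; rewrite mul0r.
Qed.

(* A sequence of pairs of badly matching translates is recentred on bounded points; along a
   subsequence the recentred factors converge, and near a cluster point of the imaginary parts
   the products must match. *)
Lemma translates_wcauchy O F Ft h g (tau : nat -> 'rV[R]_m) G1 G2 :
  convex_domain O -> hol_ap_map O F -> hol_ap_map O Ft -> (forall l, holo (tube O) (g l)) ->
  (forall l z, tube O z -> g l z * h z = F l z * Ft l z) -> zero_separated O g ->
  limit_family O (fun n z => hvec F (z + realv (tau n))) G1 ->
  limit_family O (fun n z => hvec Ft (z + realv (tau n))) G2 ->
  forall O', relcpt O' O -> forall e : R, 0 < e -> exists N, forall p q, (N <= p)%N -> (N <= q)%N ->
    forall z, tube O' z -> wclose (hvec g (z + realv (tau p))) (hvec g (z + realv (tau q))) e.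
Proof.
move=> cO apF apFt hg rel sep l1 l2 O' rO e e0; apply: contrapT => /forallNP bad.
have hgm := hol_map_product cO apF.1 apFt.1 hg rel sep.
have /choice[x Hx] : forall N, exists x : nat * nat * V,
    [/\ (N <= x.1.1)%N, (N <= x.1.2)%N, tube O' x.2 &
     ~ wclose (hvec g (x.2 + realv (tau x.1.1))) (hvec g (x.2 + realv (tau x.1.2))) e].
  move=> N; have /existsNP[p /existsNP[q]] := bad N.
  move=> /not_implyP[Np /not_implyP[Nq /existsNP[z /not_implyP[Oz nW]]]].
  by exists (p, q, z).
pose re N : 'rV[R]_m := \row_i complex.Re ((x N).2 ord0 i).
pose im N : 'rV[R]_m := im_part (x N).2.
(* The real part of the bad point is absorbed into both translations; what remains is the purely
   imaginary point [iv (im N)], whose imaginary part stays in a compact set. *)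
pose a N := tau (x N).1.1 + re N; pose b N := tau (x N).1.2 + re N.
pose iv (y : 'rV[R]_m) : V := \row_i Complex 0 (y ord0 i).
have imiv y : im_part (iv y) = y by apply/rowP => i; rewrite !mxE.
have shiftD (z : V) s t : z + realv (s + t) = z + realv t + realv s.
  by apply/rowP => i; rewrite !mxE rmorphD /= addrA addrAC.
have ivE N : iv (im N) + realv (re N) = (x N).2.
  apply/rowP => i; rewrite !mxE; case: ((x N).2 ord0 i) => u v /=.
  by apply/eqP; rewrite eq_complex /= add0r addr0 !eqxx.
have [phi1 [P [inc1 lA1]]] := almost_periodic_limit a apF.
have [phi2 [Q [inc2 lC]]] := almost_periodic_limit (a \o phi1) apFt.
pose sg n := phi1 (phi2 n).
have i1 := strict_incr_ge inc1; have i2 := strict_incr_ge inc2.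
have sgn n : (n <= sg n)%N by exact: leq_trans (i2 n) (i1 _).
have lA : limit_family O (fun n z => hvec F (z + realv (a (sg n)))) P.
  exact: (limit_family_sub i2 lA1).
(* Both indices of a bad pair tend to infinity, so the two recentred translates of [H] are close to
   the same shift of [G]. A limit of the [a]-translates is therefore also a limit of the
   [b]-translates. *)
have other (H : 'I_k.+1 -> V -> R[i]) G Y : hol_map O H ->
    limit_family O (fun n z => hvec H (z + realv (tau n))) G ->
    limit_family O (fun n z => hvec H (z + realv (a (sg n)))) Y ->
    limit_family O (fun n z => hvec H (z + realv (b (sg n)))) Y.
  move=> hH lG lY; have [_ _ Y0 cY] := lY; split=> //.
  - by move=> n l; exact: holo_hvec.
  - by move=> n z Oz; apply: (hvec_neq0 hH); rewrite tube_realv.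
  move=> U rU s s0.
  pose c : R := 6 * k.+1%:R ^+ 2.
  have c1 : 1 <= c.
    have : 1 <= k.+1%:R ^+ 2 :> R by rewrite exprn_ege1 // ler1n.
    by rewrite /c; lra.
  have c0 : 0 < c by lra.
  pose s1 : R := Num.min 1 s / c ^+ 2.
  have M0 : 0 < Num.min 1 s by rewrite lt_min ltr01.
  have s10 : 0 < s1 by rewrite divr_gt0 // exprn_gt0.
  have [m1 ms] : Num.min 1 s <= 1 /\ Num.min 1 s <= s by split; rewrite ge_min lexx ?orbT.
  have s1E : c * (c * s1) = Num.min 1 s by rewrite /s1; field; rewrite gt_eqF.
  have cs1 : s1 <= c * s1 by rewrite ler_peMl // ltW.
  have ccs : c * s1 <= c * (c * s1) by rewrite ler_peMl // mulr_ge0 // ltW.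
  have [_ _ G0 cG] := lG.
  have [N1 H1] := cG U rU _ s10; have [N2 H2] := cY U rU _ s10.
  exists (maxn N1 N2) => n; rewrite geq_max => /andP[n1 n2] z Uz.
  have Oz := relcpt_tube rU Uz.
  have [X1 X2 _ _] := Hx (sg n).
  have Uz' : tube U (z + realv (re (sg n))) by rewrite tube_realv.
  have Oz' : tube O (z + realv (re (sg n))) by rewrite tube_realv.
  have W1 : wclose (hvec H (z + realv (a (sg n)))) (G (z + realv (re (sg n)))) s1.
    by rewrite shiftD; apply: H1 => //; exact: leq_trans n1 (leq_trans (sgn n) X1).
  have W2 : wclose (hvec H (z + realv (b (sg n)))) (G (z + realv (re (sg n)))) s1.
    by rewrite shiftD; apply: H1 => //; exact: leq_trans n1 (leq_trans (sgn n) X2).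
  have W3 : wclose (hvec H (z + realv (b (sg n)))) (hvec H (z + realv (a (sg n)))) (c * s1).
    by apply: (wclose_trans (G0 _ Oz')) W2 W1; rewrite (ltW s10) /=; lra.
  have W4 : wclose (Y z) (hvec H (z + realv (a (sg n)))) (c * s1).
    by apply: (wcloseW cs1); apply/wclose_sym/H2.
  have aN0 : hvec H (z + realv (a (sg n))) != 0.
    by apply: (hvec_neq0 hH); rewrite tube_realv.
  apply: (@wcloseW _ _ _ _ (c * (c * s1))); first by lra.
  apply: (wclose_trans aN0) W3 W4.
  by rewrite mulr_ge0 ?(ltW s10) ?(ltW c0) //=; lra.
have lB := other F G1 P apF.1 l1 lA; have lD := other Ft G2 Q apFt.1 l2 lC.
have [K [cK [KO O'K]]] := rO.
have imK N : K (im N) by have [_ _ Oz _] := Hx N; exact: O'K.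
(* A cluster point is enough: a contradiction needs only one late index whose imaginary part is near
   [y]. *)
have [|y [Ky cly]] := cK ((im \o sg) @ \oo) _.
  by exists 0%N => // n _ /=.
have Oz0 : tube O (iv y) by rewrite /tube /= imiv; exact: KO.
have [d d0 Hd] := zero_separated_at sep Oz0.
have nzfam t : forall n : nat, exists l, forall w, tube O w -> vnorm (w - iv y) < d ->
    hvec g (w + realv (t n)) ord0 l != 0.
  by move=> n; have [l Hl] := Hd (t n); exists l => w Ow wd; rewrite mxE; exact: Hl.
have relfam t (n : nat) l z : tube O z ->
    hvec g (z + realv (t n)) ord0 l * h (z + realv (t n)) =
    hvec F (z + realv (t n)) ord0 l * hvec Ft (z + realv (t n)) ord0 l.
  by move=> Oz; rewrite !mxE rel // tube_realv.
have [r r0 [N HN]] := @product_families_close R m k O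
  (fun n z => hvec F (z + realv (a (sg n)))) (fun n z => hvec F (z + realv (b (sg n))))
  (fun n z => hvec Ft (z + realv (a (sg n)))) (fun n z => hvec Ft (z + realv (b (sg n))))
  (fun n z => hvec g (z + realv (a (sg n)))) (fun n z => hvec g (z + realv (b (sg n))))
  (fun n z => h (z + realv (a (sg n)))) (fun n z => h (z + realv (b (sg n))))
  P Q (iv y) d e cO lA lB lC lD
  (fun l => limit_family_translate_nonzero l apF.1 lA)
  (fun l => limit_family_translate_nonzero l apFt.1 lC)
  (fun n l => holo_hvec (a (sg n)) l hgm) (fun n l => holo_hvec (b (sg n)) l hgm)
  (relfam (a \o sg)) (relfam (b \o sg)) Oz0 d0 (nzfam (a \o sg)) (nzfam (b \o sg)) e0.
have tail : ((im \o sg) @ \oo) [set y' | exists2 n, (N <= n)%N & y' = im (sg n)].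
  by exists N => // n Nn /=; exists n.
have [y' [[n Nn ->] By]] := cly _ _ tail (nbhsx_ballx y r r0).
have near : snear (iv y) r (iv (im (sg n))).
  move: By => [_ By] i; have := By ord0 i; rewrite /ball /= distrC => By'.
  rewrite !mxE; apply: le_lt_trans By'; rewrite mxE.
  apply: le_trans (cabs_le_ReIm _) _; rewrite /= subrr normr0 add0r.
  by rewrite le_eqVlt; apply/orP; left; apply/eqP.
have [_ _ _ nW] := Hx (sg n); apply: nW.
by have := HN n Nn _ near; rewrite /a /b !shiftD !ivE.
Qed.

End Main.

Unset Implicit Arguments.
Set Strict Implicit.

Theorem theorem6p2 (R : realType) (m k : nat) (O : set 'rV[R]_m)
  (F Ft : 'I_k.+1 -> 'rV[R[i]]_m -> R[i]) (h : 'rV[R[i]]_m -> R[i])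
  (g : 'I_k.+1 -> 'rV[R[i]]_m -> R[i]) :
  convex_domain O ->
  hol_ap_map O F -> hol_ap_map O Ft ->
  holo (tube O) h -> (exists2 z, tube O z & h z != 0) ->
  (* g l = F l * Ft l / h is holomorphic on T_O *)
  (forall l, holo (tube O) (g l)) ->
  (forall l z, tube O z -> g l z * h z = F l z * Ft l z) ->
  (forall O', relcpt O' O -> exists2 delta : R, 0 < delta &
     forall z0, tube O' z0 ->
       (#|[pred l : 'I_k.+1 | `[< cball z0 delta `&` div_supp O (g l) !=set0 >]]| <= k)%N) ->
  hol_ap_map O g.
Proof.
move=> cO apF apFt _ _ hg rel sep.
have hgm := hol_map_product cO apF.1 apFt.1 hg rel sep; split=> // t.
have [phi1 [G1 [inc1 l1']]] := almost_periodic_limit t apF.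
(* Extracting from the sequence already thinned out for [F] makes both factors converge along the
   composite. *)
have [phi2 [G2 [inc2 l2]]] := almost_periodic_limit (t \o phi1) apFt.
pose phi n := phi1 (phi2 n); pose tau n := t (phi n).
have l1 : limit_family O (fun n z => hvec F (z + realv (tau n))) G1.
  exact: (limit_family_sub (strict_incr_ge inc2) l1').
have cauchy := translates_wcauchy cO apF apFt hg rel sep l1 l2.
pose K : R := 2 * k.+1%:R ^+ 2.
have K0 : 0 < K by rewrite mulr_gt0 // exprn_gt0.
(* The limit is chosen separately at each point, but its rate [K * e] is inherited from the Cauchy
   bound with the same [N], so convergence is uniform on each [tube O']. *)
have /choice[G HG] : forall z, exists y : 'rV[R[i]]_k.+1, tube O z -> y != 0 /\
    forall (e : R) N, 0 <= e ->
      (forall p q, (N <= p)%N -> (N <= q)%N ->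
         wclose (hvec g (z + realv (tau p))) (hvec g (z + realv (tau q))) e) ->
      forall p, (N <= p)%N -> wclose (hvec g (z + realv (tau p))) y (K * e).
  move=> z; have [Oz|nOz] := pselect (tube O z); last by exists 0.
  have [||y y0 Hy] := @wcauchy_limit R k.+1 (fun p => hvec g (z + realv (tau p))).
  - by move=> p; apply: (hvec_neq0 hgm); rewrite tube_realv.
  - move=> e e0; have [N HN] := cauchy _ (relcpt_set1 Oz) e e0.
    by exists N => p q Np Nq; exact: HN.
  by exists y.
exists phi, G; split.
  have mono i j : (i < j)%N -> (phi1 i < phi1 j)%N.
    exact: (homo_ltn ltn_trans inc1).
  by move=> n; exact: mono.
split; first by move=> z /HG[].
move=> O' rO eps eps0; have [d d0 Hd] := @wclose_fs_dist R k.+1 eps eps0.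
have [N HN] := cauchy O' rO (d / K) (divr_gt0 d0 K0).
exists N => n Nn z Oz; have [G0 HGz] := HG z (relcpt_tube rO Oz).
apply: Hd => //; first by apply: (hvec_neq0 hgm); rewrite tube_realv; exact: relcpt_tube rO Oz.
have -> : d = K * (d / K) by rewrite mulrC divfK // gt_eqF.
apply: (HGz _ N) => //; first by rewrite ltW // divr_gt0.
by move=> p q Np Nq; exact: HN.
Qed.
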